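(* Let $\{((A_n,L_n),\phi_n)\}_{n\ge 1}$ be an inductive sequence of compact quantum metric spaces, let $A=\varinjlim(A_n,\phi_n)$ be the inductive limit $C^*$-algebra with canonical unital $^*$-homomorphisms $\phi^n:A_n\to A$, let $\rho$ be the metric on $\mathcal{S}(A)$ given by $$\rho(\mu,\nu)=\sum_{n=1}^\infty\frac{1}{2^n}\,\frac{\rho_{L_n}(\mu\circ\phi^n,\nu\circ\phi^n)}{1+\rho_{L_n}(\mu\circ\phi^n,\nu\circ\phi^n)},\qquad \mu,\nu\in\mathcal{S}(A),$$ and let $$L(a)=\sup\left\{\frac{|\mu(a)-\nu(a)|}{\rho(\mu,\nu)}:\mu,\nu\in\mathcal{S}(A),\ \mu\neq\nu\right\}\in[0,+\infty],\qquad a\in A.$$ Then $L$ is a Lip-norm on $A$, i.e., $(A,L)$ is a compact quantum metric space.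
   Context: For a unital $C^*$-algebra $A$, $\mathbf{1}_A$ is its identity and $\mathcal{S}(A)$ its state space. A Lipschitz seminorm on $A$ is a seminorm $L:A\to[0,+\infty]$ (the value $+\infty$ is permitted) such that (1) $L(a^* )=L(a)$ for all $a\in A$; (2) $L(a)=0$ if and only if $a\in\mathbb{C}\mathbf{1}_A$; (3) $\mathrm{dom}(L)=\{a\in A: L(a)<+\infty\}$ is a (norm-)dense subspace of $A$. A Lip-norm on $A$ is a Lipschitz seminorm $L$ such that the topology on $\mathcal{S}(A)$ induced by the Monge-Kantorovich metric $\rho_L(\mu,\nu)=\sup\{|\mu(a)-\nu(a)|: a\in A,\ L(a)\le 1\}$ coincides with the weak$^*$-topology. A compact quantum metric space is a pair $(A,L)$ with $A$ a unital $C^*$-algebra and $L$ a Lip-norm on $A$. An inductive sequence of compact quantum metric spaces $\{((A_n,L_n),\phi_n)\}_{n\ge1}$ consists of compact quantum metric spaces $(A_n,L_n)$ and unital $^*$-homomorphisms $\phi_n:A_n\to A_{n+1}$ (not assumed injective) with $\phi_n(\mathrm{dom}(L_n))\subset\mathrm{dom}(L_{n+1})$ for all $n$. The canonical maps into the inductive limit satisfy $\phi^{n+1}\circ\phi_n=\phi^n$, and $\bigcup_n\phi^n(A_n)$ is dense in $A$. *)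

(* Defs.v *)
From HB Require Import structures.
From mathcomp Require Import all_boot all_order all_algebra.
From mathcomp Require Import complex.
From mathcomp Require Import all_classical all_reals all_analysis.

Set Implicit Arguments.
Unset Strict Implicit.
Unset Printing Implicit Defensive.
Import Order.TTheory GRing.Theory Num.Theory.
Import numFieldNormedType.Exports.
Local Open Scope classical_set_scope.
Local Open Scope ring_scope.

(* The library's `|z| is an element of R[i]; cabs z is the same number in R. *)
Definition cabs (R : realType) (z : R[i]) : R := complex.Re `|z|.

(* Unital C*-algebras over the complex numbers R[i], with a real-valued norm.
   They do not extend the library's normedModType because its hierarchy admits
   no common substructure of nzRingType and normedZmodType other than
   numDomainType; instead the norm is tied to the uniform structure by
   cnorm_entourage. The library's algebras satisfy 1 != 0, so the zero algebra
   is excluded. *)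
HB.mixin Record Algebra_isCStar (R : realType) A
    & GRing.Algebra R[i] A & Uniform A := {
  cnorm : A -> R;
  cnorm_eq0 : forall a : A, cnorm a = 0 -> a = 0;
  cnormD : forall a b : A, cnorm (a + b) <= cnorm a + cnorm b;
  cnormZ : forall (c : R[i]) (a : A), cnorm (c *: a) = cabs c * cnorm a;
  cnormM : forall a b : A, cnorm (a * b) <= cnorm a * cnorm b;
  cnorm_entourage : @entourage A = [set E | exists2 e : R, 0 < e &
    forall a b : A, cnorm (a - b) < e -> E (a, b)];
  cnorm_complete : forall F : set_system A, ProperFilter F -> cauchy F ->
    exists l : A, F --> l;
  star : A -> A;
  starK : involutive star;
  starD : {morph star : a b / a + b};
  starZ : forall (c : R[i]) (a : A), star (c *: a) = conjc c *: star a;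
  starM : forall a b : A, star (a * b) = star b * star a;
  cstar_identity : forall a : A, cnorm (star a * a) = cnorm a ^+ 2
}.

#[short(type="cstarAlgType")]
HB.structure Definition CStarAlgebra (R : realType) :=
  {A of GRing.Algebra R[i] A & Uniform A & Algebra_isCStar R A}.

Section CStarAlgebraNotions.
Context {R : realType}.
Implicit Types A B : cstarAlgType R.

(* {lrmorphism A -> B} is the library's type of unital algebra homomorphisms. *)
Definition star_preserving A B (f : A -> B) := forall a, f (star a) = star (f a).

Definition spectrum A (a : A) : set R[i] :=
  [set z | ~ exists b, b * (a - z%:A) = 1 /\ (a - z%:A) * b = 1].

(* In R[i], 0 <= z means that z is real and nonnegative. *)
Definition positive_elt A (a : A) :=
  star a = a /\ (forall z, spectrum a z -> 0 <= z).

Definition functional_norm A (f : A -> R[i]) : \bar R :=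
  ereal_sup [set (cabs (f a))%:E | a in [set a : A | cnorm a <= 1]].

(* The positive linear functionals of norm 1. As a set in the space of
   functions with the topology of pointwise convergence, its associated type
   (of which the coercion set_type is the library's name) carries the induced
   topology, which is the weak* topology. *)
Definition state_space A : set {ptws A -> R[i]^o} :=
  [set f | [/\ scalar f,
               forall a, positive_elt a -> 0 <= (f a : R[i])
             & functional_norm f = 1%E]].
Arguments state_space A : clear implicits.

(* Defined on arbitrary functionals, so that it applies to mu \o phi without
   first proving that mu \o phi is a state. *)
Definition mk_dist A (L : A -> \bar R) (f g : A -> R[i]) : \bar R :=
  ereal_sup [set (cabs (f a - g a))%:E | a in [set a | (L a <= 1)%E]].

Definition mk_open A (L : A -> \bar R) (U : set (state_space A)) :=
  forall mu, U mu -> exists2 e : R, 0 < e &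
    forall nu : state_space A, (mk_dist L (\val mu) (\val nu) < e%:E)%E -> U nu.

(* With 0 * +oo = 0, as in the library, absolute homogeneity holds for all c. *)
Record lipschitz_seminorm A (L : A -> \bar R) : Prop := LipschitzSeminorm {
  lips_ge0 : forall a, (0 <= L a)%E;
  lips_triangle : forall a b : A, (L (a + b)%R <= L a + L b)%E;
  lips_scale : forall (c : R[i]) (a : A), L (c *: a) = ((cabs c)%:E * L a)%E;
  lips_star : forall a, L (star a) = L a;
  lips_eq0 : forall a, L a = 0%E <-> exists c : R[i], a = c%:A;
  lips_dense : dense [set a | (L a < +oo)%E]
}.

Record lip_norm A (L : A -> \bar R) : Prop := LipNorm {
  lip_norm_seminorm : lipschitz_seminorm L;
  lip_norm_topology : forall U : set (state_space A), mk_open L U <-> open U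
}.

(* The colimit in the category of unital C*-algebras and unital
   *-homomorphisms. Density of the union of the images follows from the
   universal property. *)
Record inductive_limit (A : nat -> cstarAlgType R)
    (phi : forall n, {lrmorphism A n -> A n.+1})
    (Alim : cstarAlgType R) (psi : forall n, {lrmorphism A n -> Alim}) : Prop :=
  InductiveLimit {
  indlim_star : forall n, star_preserving (psi n);
  indlim_comp : forall n a, psi n.+1 (phi n a) = psi n a;
  indlim_dense : dense (\bigcup_n range (psi n));
  indlim_univ : forall (B : cstarAlgType R) (th : forall n, {lrmorphism A n -> B}),
    (forall n, star_preserving (th n)) ->
    (forall n a, th n.+1 (phi n a) = th n a) ->
    exists u : {lrmorphism Alim -> B},
      [/\ star_preserving u,
          forall n a, u (psi n a) = th n a
        & forall v : {lrmorphism Alim -> B}, star_preserving v ->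
            (forall n a, v (psi n a) = th n a) -> v =1 u]
}.

Section LimitSeminorm.
Variables (A : nat -> cstarAlgType R) (L : forall n, A n -> \bar R).
Variables (Alim : cstarAlgType R) (psi : forall n, A n -> Alim).

(* Indices start at 0, hence the weights 2 ^- n.+1. For Lip-norms the
   Monge-Kantorovich distance between states is finite, so that fine loses
   nothing. *)
Definition limit_dist (mu nu : Alim -> R[i]) : R :=
  limn (series (fun n =>
    let d := fine (mk_dist (@L n) (mu \o @psi n) (nu \o @psi n)) in
    2 ^- n.+1 * (d / (1 + d)))).

(* The supremum is taken in [0, +oo]: it is 0 if there is only one state. *)
Definition limit_seminorm (a : Alim) : \bar R :=
  maxe 0%E (ereal_sup
    [set x | exists mu nu : state_space Alim, mu <> nu /\
      x = (cabs (\val mu a - \val nu a)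
             / limit_dist (\val mu) (\val nu))%:E]).

End LimitSeminorm.
End CStarAlgebraNotions.

Arguments state_space {R} A.

(* Main.v *)
Require Import Defs.
From HB Require Import structures.
From mathcomp Require Import all_boot all_order all_algebra.
From mathcomp Require Import complex.
From mathcomp Require Import all_classical all_reals all_analysis.
From mathcomp Require Import ring lra.

Set Implicit Arguments.
Unset Strict Implicit.
Unset Printing Implicit Defensive.
Import Order.TTheory GRing.Theory Num.Theory.
Import numFieldNormedType.Exports.
Local Open Scope classical_set_scope.
Local Open Scope ring_scope.

(* For a Lip-norm the Monge-Kantorovich distance of states is bounded, because a
   weak* neighbourhood of one state contains a dilate of the whole (convex)
   state space. So the terms of the series defining rho control the individual
   distances, elements of the images of dom(L_n) are rho-Lipschitz, and dom(L)
   is dense. An element on which all states agree is scalar because states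
   separate points (Hahn-Banach applied to the norm, with the norm of a
   self-adjoint element attained on its spectrum). For the topology: the distance
   of L is at most rho, and a rho-ball contains a weak* neighbourhood since
   finitely many terms matter; conversely, states have norm 1 and dom(L) is
   dense, so closeness for L controls finitely many evaluations. *)

(** The analytic core is that the norm of a self-adjoint element is, up to sign, a spectral value.
    The spectral radius formula and the functional calculus are replaced by repeated squaring, with
    a norm bound coming from the Cayley transform. The fact serves three times: it makes
    star-preserving unital homomorphisms contractive, so that density of dom(L_n) survives in the
    limit; it turns positivity into a norm inequality; and it lets a Hahn-Banach functional norm
    [1 + h], hence [1] and [h] at once, which yields a state. Density of the Lipschitz elements also
    gives rho > 0 on distinct states, so that the quotients defining L are genuine and not divisions
    by 0. *)

Section ComplexModulus.
Context {R : realType}.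
Implicit Types (z w : R[i]) (r : R).

Lemma cabsE z : `|z| = (cabs z)%:C%C.
Proof. by rewrite /cabs normc_def. Qed.

Lemma cabs_sqrt z : cabs z = Num.sqrt (complex.Re z ^+ 2 + complex.Im z ^+ 2).
Proof. by rewrite /cabs normc_def. Qed.

Lemma cabs_ge0 z : 0 <= cabs z.
Proof. by rewrite cabs_sqrt sqrtr_ge0. Qed.

Lemma cabs_sqr z : cabs z ^+ 2 = complex.Re z ^+ 2 + complex.Im z ^+ 2.
Proof. by rewrite cabs_sqrt sqr_sqrtr// addr_ge0// sqr_ge0. Qed.

Lemma cabsM z w : cabs (z * w) = cabs z * cabs w.
Proof. by apply: complexI; rewrite -cabsE normrM !cabsE rmorphM. Qed.

Lemma cabsD z w : cabs (z + w) <= cabs z + cabs w.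
Proof. by rewrite -lecR rmorphD /= -!cabsE ler_normD. Qed.

Lemma cabsN z : cabs (- z) = cabs z.
Proof. by rewrite /cabs normrN. Qed.

Lemma cabsB z w : cabs (z - w) = cabs (w - z).
Proof. by rewrite -opprB cabsN. Qed.

Lemma cabs0 : cabs (0 : R[i]) = 0.
Proof. by rewrite /cabs normr0. Qed.

Lemma cabs1 : cabs (1 : R[i]) = 1.
Proof. by rewrite /cabs normr1. Qed.

Lemma cabs_real r : cabs r%:C%C = `|r|.
Proof. by rewrite cabs_sqrt /= expr0n addr0 sqrtr_sqr. Qed.

Lemma cabs_conj z : cabs (conjc z) = cabs z.
Proof. by rewrite /cabs normcJ. Qed.

Lemma Re_le_cabs z : complex.Re z <= cabs z.
Proof. by apply: (le_trans (ler_norm _)); rewrite -lecR -cabsE normc_ge_Re. Qed.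

Lemma cabs_eq0 z : cabs z = 0 -> z = 0.
Proof. by move=> h; apply/normr0_eq0; rewrite cabsE h. Qed.

Lemma cabs_gt0 z : z != 0 -> 0 < cabs z.
Proof.
by move=> z0; rewrite lt_neqAle cabs_ge0 andbT eq_sym; apply: contra_neq z0 => /cabs_eq0.
Qed.

Lemma cabsV z : cabs z^-1 = (cabs z)^-1.
Proof. by rewrite /cabs normfV -/(cabs z) cabsE -fmorphV. Qed.

Definition cI : R[i] := Complex 0 1.

Lemma cI_sqr : cI * cI = -1.
Proof. by rewrite -expr2 sqr_i. Qed.

Lemma cabs_cI : cabs cI = 1.
Proof. by rewrite cabs_sqrt /= expr0n expr1n add0r sqrtr1. Qed.

Lemma conj_cI : conjc cI = - cI.
Proof. by apply/eqP; rewrite eq_complex /= oppr0 !eqxx. Qed.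

Lemma conjcD z w : conjc (z + w) = conjc z + conjc w.
Proof. exact: (rmorphD (@conjc R)). Qed.

Lemma conjcM z w : conjc (z * w) = conjc z * conjc w.
Proof. exact: (rmorphM (@conjc R)). Qed.

Lemma conj_NcI : conjc (- cI) = cI.
Proof. by apply/eqP; rewrite eq_complex /= oppr0 opprK !eqxx. Qed.

Lemma ReD z w : complex.Re (z + w) = complex.Re z + complex.Re w.
Proof. by case: z w => [? ?] [? ?]. Qed.

Lemma ImD z w : complex.Im (z + w) = complex.Im z + complex.Im w.
Proof. by case: z w => [? ?] [? ?]. Qed.

Lemma ReN z : complex.Re (- z) = - complex.Re z.
Proof. by case: z. Qed.

Lemma ImN z : complex.Im (- z) = - complex.Im z.
Proof. by case: z. Qed.

Lemma Re_realM r z : complex.Re (r%:C%C * z) = r * complex.Re z.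
Proof. by case: z => ? ? /=; rewrite mul0r subr0. Qed.

Lemma Im_realM r z : complex.Im (r%:C%C * z) = r * complex.Im z.
Proof. by case: z => ? ? /=; rewrite mul0r addr0. Qed.

Lemma complex_ReIm z : z = (complex.Re z)%:C%C + cI * (complex.Im z)%:C%C.
Proof. exact: complexE. Qed.

End ComplexModulus.
Arguments cI R : clear implicits.

(** * Elementary norm, involution and invertibility rules *)

Section NormAndStar.
Context {R : realType} {A : cstarAlgType R}.
Implicit Types (a b : A) (c : R[i]).

Lemma cnorm0 : cnorm (0 : A) = 0.
Proof. by rewrite -(scale0r (0 : A)) cnormZ cabs0 mul0r. Qed.

Lemma cnormN a : cnorm (- a) = cnorm a.
Proof. by rewrite -scaleN1r cnormZ cabsN cabs1 mul1r. Qed.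

Lemma cnormBC a b : cnorm (a - b) = cnorm (b - a).
Proof. by rewrite -opprB cnormN. Qed.

Lemma cnormB a b : cnorm (a - b) <= cnorm a + cnorm b.
Proof. by rewrite (le_trans (cnormD _ _))// cnormN. Qed.

Lemma cnorm_ge0 a : 0 <= cnorm a.
Proof.
by have := cnormB a a; rewrite subrr cnorm0 => h; lra.
Qed.

Lemma cnorm_sub_trans b a d : cnorm (a - d) <= cnorm (a - b) + cnorm (b - d).
Proof. by rewrite -(subrKA b); apply: cnormD. Qed.

Lemma star0 : star (0 : A) = 0.
Proof. by apply: (addrI (star (0 : A))); rewrite -starD !addr0. Qed.

Lemma starN a : star (- a) = - star a.
Proof. by apply: (addrI (star a)); rewrite -starD !subrr star0. Qed.

Lemma starB a b : star (a - b) = star a - star b.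
Proof. by rewrite starD starN. Qed.

Lemma star1 : star (1 : A) = 1.
Proof. by rewrite -[LHS]mulr1 -[X in _ * X]starK -starM mulr1 starK. Qed.

Lemma starA c : star (c%:A : A) = (conjc c)%:A.
Proof. by rewrite starZ star1. Qed.

Lemma cnorm_star a : cnorm (star a) = cnorm a.
Proof.
suff H b : cnorm b <= cnorm (star b).
  by apply: le_anti; rewrite H andbT -{2}(starK a) H.
have [->|n0] := eqVneq (cnorm b) 0; first exact: cnorm_ge0.
have b0 : 0 < cnorm b by rewrite lt_neqAle eq_sym n0 cnorm_ge0.
by rewrite -(ler_pM2r b0) -expr2 -cstar_identity cnormM.
Qed.

Lemma cnorm1 : cnorm (1 : A) = 1.
Proof.
have h : cnorm (1 : A) = cnorm (1 : A) ^+ 2 by rewrite -cstar_identity star1 mulr1.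
have n0 : cnorm (1 : A) != 0.
  by apply/eqP => /cnorm_eq0 /eqP; rewrite oner_eq0.
by apply: (mulfI n0); rewrite mulr1 -expr2 -h.
Qed.

Lemma cnormA c : cnorm (c%:A : A) = cabs c.
Proof. by rewrite cnormZ cnorm1 mulr1. Qed.

Lemma cnorm_sqr_selfadjoint a : star a = a -> cnorm (a ^+ 2) = cnorm a ^+ 2.
Proof. by move=> sa; rewrite -cstar_identity sa expr2. Qed.

Lemma starX a n : star (a ^+ n) = star a ^+ n.
Proof. by elim: n => [|n IH]; rewrite ?expr0 ?star1// exprS starM IH -exprSr. Qed.

End NormAndStar.

Section Invertibility.
Context {R : realType} {A : cstarAlgType R}.
Implicit Types (a b x : A) (c : R[i]) (r : R).

Definition invertible a := exists b, b * a = 1 /\ a * b = 1.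

Lemma invertibleM a b : invertible a -> invertible b -> invertible (a * b).
Proof.
move=> [a' [a1 a2]] [b' [b1 b2]]; exists (b' * a'); split.
  by rewrite mulrA -(mulrA b') a1 mulr1 b1.
by rewrite mulrA -(mulrA a) b2 mulr1 a2.
Qed.

Lemma invertibleZ c a : c != 0 -> invertible a -> invertible (c *: a).
Proof.
move=> c0 [b [b1 b2]]; exists (c^-1 *: b).
by rewrite -!scalerAl -!scalerAr !scalerA mulVf ?mulfV// !scale1r b1 b2.
Qed.

Lemma cnormX a n : cnorm (a ^+ n) <= cnorm a ^+ n.
Proof.
elim: n => [|n IH]; first by rewrite !expr0 cnorm1.
by rewrite !exprS (le_trans (cnormM _ _))// ler_wpM2l// cnorm_ge0.
Qed.

End Invertibility.

(** * Completeness and the Neumann series *)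

Section Neumann.
Context {R : realType} {A : cstarAlgType R}.
Implicit Types (a b x : A) (c : R[i]) (r : R).

(** Completeness is given for Cauchy filters; the filter [u @ \oo] of tails turns it into the
    sequential form that the Neumann series uses. *)
Lemma cnorm_sequence_complete (u : nat -> A) :
  (forall e : R, 0 < e -> exists N, forall m n, (N <= m)%N -> (N <= n)%N ->
     cnorm (u m - u n) < e) ->
  exists l, forall e : R, 0 < e -> exists N, forall n, (N <= n)%N ->
     cnorm (u n - l) < e.
Proof.
move=> hu; have [|l hl] := @cnorm_complete R A (u @ \oo) _.
  move=> E; rewrite cnorm_entourage => -[e e0 hE].
  have [N hN] := hu _ e0.
  exists ([set a | exists2 n, (N <= n)%N & u n = a],
          [set a | exists2 n, (N <= n)%N & u n = a]).
    by split; exists N => // n /= Nn; exists n.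
  by move=> [a b] [/= [m Nm <-] [n Nn <-]]; apply: hE; apply: hN.
exists l => e e0.
have /hl [N _ hN] : nbhs l [set a | cnorm (a - l) < e].
  apply/nbhsP; exists [set ab | cnorm (ab.1 - ab.2) < e].
    by rewrite cnorm_entourage; exists e.
  by move=> a; rewrite /xsection /= inE /= cnormBC.
by exists N => n Nn; apply: hN.
Qed.

Lemma geometric_small r e : 0 <= r < 1 -> 0 < e -> exists N, r ^+ N < e.
Proof.
move=> /andP[r0 r1] e0.
have /cvg_expr/cvgrPdist_lt/(_ e e0) [N _ hN] : `|r| < 1 by rewrite ger0_norm.
by exists N; have := hN N (leqnn N); rewrite /= sub0r normrN ger0_norm ?exprn_ge0.
Qed.

Lemma neumann x : cnorm x < 1 -> invertible (1 - x).
Proof.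
move=> x1; set r := cnorm x in x1; have r0 : 0 <= r := cnorm_ge0 x.
pose u n := \sum_(k < n) x ^+ k.
have uS n : u n.+1 = u n + x ^+ n by rewrite /u big_ord_recr.
have uR n : (1 - x) * u n = 1 - x ^+ n.
  elim: n => [|n IH]; first by rewrite /u big_ord0 mulr0 expr0 subrr.
  by rewrite uS mulrDr IH mulrBl mul1r -exprS addrA addrNK.
have uL n : u n * (1 - x) = 1 - x ^+ n.
  elim: n => [|n IH]; first by rewrite /u big_ord0 mul0r expr0 subrr.
  by rewrite uS mulrDl IH mulrBr mulr1 -exprSr addrA addrNK.
(* Multiplying by [1 - r] instead of dividing lets the bound telescope: the new term contributes at
   most [r ^+ (n + k) * (1 - r)]. *)
have ud n k : cnorm (u (n + k)%N - u n) * (1 - r) <= r ^+ n - r ^+ (n + k).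
  elim: k => [|k IH]; first by rewrite addn0 !subrr cnorm0 mul0r.
  rewrite addnS uS addrAC exprS.
  have := cnormD (u (n + k)%N - u n) (x ^+ (n + k)).
  have := cnormX x (n + k); rewrite -/r => h1 h2.
  have h3 : 0 <= 1 - r by rewrite subr_ge0 ltW.
  have := ler_wpM2r h3 (le_trans h2 (lerD (lexx _) h1)) => h4.
  apply: (le_trans h4); rewrite mulrDl; nra.
have u0 : 0 < 1 - r by rewrite subr_gt0.
have rX n m : (n <= m)%N -> r ^+ m <= r ^+ n.
  by move=> nm; apply: ler_wiXn2l => //; apply: ltW.
have [|l hl] := @cnorm_sequence_complete u.
  move=> e e0; have [||N hN] := @geometric_small r (e * (1 - r) / 2).
  - by rewrite r0.
  - by apply: divr_gt0 => //; apply: mulr_gt0.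
  have H n : (N <= n)%N -> cnorm (u n - u N) < e / 2.
    move=> Nn; rewrite -(ltr_pM2r u0).
    have := ud N (n - N)%N; rewrite subnKC// => h.
    have : 0 <= r ^+ n by rewrite exprn_ge0.
    lra.
  exists N => m n Nm Nn.
  apply: (le_lt_trans (cnorm_sub_trans (u N) _ _)).
  rewrite [X in _ + X]cnormBC [e]splitr; apply: ltrD; exact: H.
have lim0 a : (forall e : R, 0 < e -> cnorm a <= e) -> a = 0.
  move=> h; apply: cnorm_eq0; apply: le_anti; rewrite cnorm_ge0 andbT.
  by apply/ler_addgt0Pr => e e0; rewrite add0r h.
have N1x : cnorm (1 - x) < 2.
  by apply: (le_lt_trans (cnormB _ _)); rewrite cnorm1 -/r; lra.
(* [e / 4] because it gets multiplied by [cnorm (1 - x) < 2]; the other half of [e] goes to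
   [x ^+ n]. *)
have key e : 0 < e -> exists n, cnorm (u n - l) <= e / 4 /\ cnorm (x ^+ n) <= e / 2.
  move=> e0; have [N1 h1] := hl (e / 4) (divr_gt0 e0 (ltr0Sn _ _)).
  have [|N2 h2] := @geometric_small r (e / 2) _ (divr_gt0 e0 (ltr0Sn _ _)).
    by rewrite r0.
  exists (maxn N1 N2); split; first by rewrite ltW// h1// leq_maxl.
  apply: (le_trans (cnormX _ _)); rewrite -/r (le_trans _ (ltW h2))//.
  by rewrite rX// leq_maxr.
exists l; split; apply/eqP; rewrite -subr_eq0; apply/eqP/lim0 => e /key[n [h1 h2]].
  have -> : l * (1 - x) - 1 = - ((u n - l) * (1 - x)) - x ^+ n.
    by rewrite mulrBl uL opprB -addrA; congr (_ + _); rewrite opprB addrAC addrN sub0r.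
  apply: (le_trans (cnormB _ _)); rewrite cnormN.
  have := cnormM (u n - l) (1 - x).
  have := cnorm_ge0 (u n - l); have := cnorm_ge0 (1 - x); nra.
have -> : (1 - x) * l - 1 = - ((1 - x) * (u n - l)) - x ^+ n.
  by rewrite mulrBr uR opprB -addrA; congr (_ + _); rewrite opprB addrAC addrN sub0r.
apply: (le_trans (cnormB _ _)); rewrite cnormN.
have := cnormM (1 - x) (u n - l).
have := cnorm_ge0 (u n - l); have := cnorm_ge0 (1 - x); nra.
Qed.

End Neumann.

(** * Spectra of self-adjoint elements *)

Section SelfAdjointSpectrum.
Context {R : realType} {A : cstarAlgType R}.
Implicit Types (a b h x y : A) (c z : R[i]) (r s : R).

Lemma spectrumN a z : spectrum a z -> spectrum (- a) (- z).
Proof.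
move=> az inv; apply: az.
have -> : a - z%:A = (-1) *: (- a - (- z)%:A) by rewrite scaleN1r scaleNr opprK opprD opprK.
by apply: invertibleZ inv; rewrite oppr_eq0 oner_eq0.
Qed.

Lemma spectrum_shift a z c : spectrum a z -> spectrum (a + c%:A) (z + c).
Proof.
by rewrite /spectrum /= scalerDl opprD addrACA subrr addr0.
Qed.

Lemma spectrum_unshift a z c : spectrum (a + c%:A) z -> spectrum a (z - c).
Proof. by move/(spectrum_shift (c := - c)); rewrite scaleNr addrK. Qed.

Lemma spectrum_le_norm a z : spectrum a z -> cabs z <= cnorm a.
Proof.
move=> az; rewrite leNgt; apply/negP => lt; apply: az.
have z0 : z != 0 by apply: contraTneq lt => ->; rewrite cabs0 -leNgt cnorm_ge0.
have -> : a - z%:A = (- z) *: (1 - z^-1 *: a).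
  by rewrite scalerBr scalerA mulNr mulfV// scaleN1r opprK scaleNr addrC.
apply: invertibleZ; first by rewrite oppr_eq0.
apply: neumann; rewrite cnormZ cabsV mulrC ltr_pdivrMr ?mul1r//.
by rewrite (le_lt_trans (cnorm_ge0 a)).
Qed.

Lemma spectrum_selfadjoint_real b z : star b = b -> spectrum b z -> complex.Im z = 0.
Proof.
move=> sb bz.
(* Arens' trick: compare z + is with the norm of b + is for all real s. *)
have H s : complex.Re z ^+ 2 + (complex.Im z + s) ^+ 2 <= cnorm b ^+ 2 + s ^+ 2.
  pose w := cI R * s%:C%C.
  have wE : w = Complex 0 s by apply/eqP; rewrite eq_complex /= !mul0r !mul1r subr0 add0r !eqxx.
  have := spectrum_le_norm (spectrum_shift (c := w) bz).
  rewrite -ler_sqr ?nnegrE ?cabs_ge0 ?cnorm_ge0// cabs_sqr -(cstar_identity (b + _)).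
  have -> : complex.Re (z + w) = complex.Re z by rewrite ReD wE /= addr0.
  have -> : complex.Im (z + w) = complex.Im z + s by rewrite ImD wE.
  move=> /le_trans; apply.
  have -> : star (b + w%:A) * (b + w%:A) = b * b + ((s ^+ 2)%:C%C)%:A.
    rewrite starD starA sb.
    have -> : conjc w = - w by rewrite wE; apply/eqP; rewrite eq_complex /= oppr0 !eqxx.
    rewrite scaleNr mulrDl mulrDr mulNr -addrA; congr (_ + _).
    rewrite mulrDr -!scalerAl -scalerAr !mul1r mulr1 opprD addrA subrr add0r scalerA -scaleNr.
    by congr (_ *: _); rewrite /w mulrACA cI_sqr mulN1r opprK -rmorphM -expr2.
  apply: (le_trans (cnormD _ _)); rewrite cnormA cabs_real ger0_norm ?sqr_ge0//.
  by rewrite lerD2r -expr2 cnorm_sqr_selfadjoint.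
set al := complex.Re z in H; set be := complex.Im z in H *.
(* After cancelling [s ^+ 2], [H] reads al^2 + be^2 + 2 be s <= cnorm b ^+ 2, linear in s. For be !=
   0 this s gives be s = cnorm b ^+ 2 + 1, a contradiction. *)
have H0 := H ((cnorm b ^+ 2 + 1) / be).
apply/eqP/negPn/negP => be0.
have e : be * ((cnorm b ^+ 2 + 1) / be) = cnorm b ^+ 2 + 1 by rewrite mulrC divfK.
set t := _ / be in H0 e.
have := sqr_ge0 (cnorm b); have := sqr_ge0 al; have := sqr_ge0 be; nra.
Qed.

Lemma inverse_comm a b x : x * b = 1 -> b * x = 1 -> a * b = b * a -> a * x = x * a.
Proof.
by move=> xb bx ab; rewrite -[LHS]mul1r -xb -mulrA (mulrA b) -ab -mulrA bx mulr1.
Qed.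

(* y / (1 + y^2) = (u - u^* ) / 4i for the Cayley transform u of y. *)
Lemma cayley_bound y : star y = y ->
  exists v, v * (1 + y ^+ 2) = 1 /\ cnorm (y * v) <= 1 / 2.
Proof.
move=> sy; pose p : A := 1 + cI R *: y; pose q : A := 1 - cI R *: y.
have cI0 : cI R != 0 by apply/eqP => -[] /eqP; rewrite oner_eq0.
have nreal z : complex.Im z != 0 -> invertible (y - z%:A).
  by move=> z0; apply: contrapT => /(spectrum_selfadjoint_real sy) /eqP; apply/negP.
have pE : p = cI R *: (y - (cI R)%:A).
  by rewrite scalerBr scalerA cI_sqr scaleN1r opprK addrC.
have qE : q = - cI R *: (y - (- cI R)%:A).
  by rewrite scalerBr scalerA mulrNN cI_sqr scaleN1r opprK addrC scaleNr.
have [p' [p'p pp']] : invertible p.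
  by rewrite pE; apply: invertibleZ => //; apply: nreal; rewrite oner_eq0.
have [q' [q'q qq']] : invertible q.
  rewrite qE; apply: invertibleZ; rewrite ?oppr_eq0//; apply: nreal.
  by rewrite ImN oppr_eq0 oner_eq0.
have pq : p * q = 1 + y ^+ 2.
  rewrite /p /q mulrBr mulr1 mulrDl mul1r opprD addrA addrK -scalerAl -scalerAr.
  by rewrite scalerA cI_sqr scaleN1r opprK expr2.
have qp : q * p = 1 + y ^+ 2.
  rewrite /p /q mulrDr mulr1 mulrBl mul1r addrA addrNK -scalerAl -scalerAr.
  by rewrite scalerA cI_sqr scaleN1r opprK expr2.
have sp : star p = q by rewrite starD star1 starZ sy conj_cI scaleNr.
have sq : star q = p by rewrite -sp starK.
have pq' : p * q' = q' * p by apply: (inverse_comm q'q qq'); rewrite pq qp.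
have qp' : q * p' = p' * q by apply: (inverse_comm p'p pp'); rewrite pq qp.
have sq' : star q' = p'.
  rewrite -[LHS]mul1r -p'p -mulrA.
  by rewrite -{1}sq -starM q'q star1 mulr1.
pose u := p * q'; have su : star u = p' * q by rewrite /u starM sq' sp.
have cu : cnorm u = 1.
  apply/eqP; rewrite -(@eqrXn2 _ 2) ?cnorm_ge0// expr1n -cstar_identity su /u.
  by rewrite -mulrA (mulrA q) qp -pq -mulrA qq' mulr1 p'p cnorm1.
exists (q' * p'); split.
  by rewrite -pq -mulrA (mulrA p') p'p mul1r.
(* Over the common denominator p q, [u - star u] has numerator p^2 - q^2 = (p - q)(p + q) = (2i y)
   2, whence the factor 4i. Since u is unitary, the left side has norm at most 2. *)
have e4 : (4%:R * cI R) *: (y * (q' * p')) = u - star u.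
  have -> : (4%:R * cI R) *: (y * (q' * p')) = (p - q) * (p + q) * (q' * p').
    have -> : p - q = (2%:R * cI R) *: y.
      rewrite /p /q opprB addrC subrKA.
      by rewrite -scalerDl -mulr2n mulr_natl.
    have -> : p + q = 2%:R%:A by rewrite /p /q addrACA subrr addr0 scaler_nat.
    by rewrite -!scalerAl -scalerAr mulr1 -scalerAl scalerA; congr (_ *: _); ring.
  have -> : (p - q) * (p + q) = p * p - q * q.
    by rewrite mulrDr [(p - q) * p]mulrBl [(p - q) * q]mulrBl pq qp addrA addrNK.
  rewrite [LHS]mulrBl su /u; congr (_ - _).
    by rewrite -mulrA (mulrA p q') pq' -mulrA pp' mulr1.
  by rewrite -mulrA (mulrA q q') qq' mul1r qp'.
have := cnormB u (star u); rewrite -e4 cnormZ cabsM cabs_cI mulr1 cnorm_star cu.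
have -> : (4%:R : R[i]) = (4%:R)%:C%C by rewrite rmorph_nat.
by rewrite cabs_real ger0_norm// => ?; lra.
Qed.

Lemma selfadjoint_pow2_norm b k : star b = b -> cnorm (b ^+ (2 ^ k)) = cnorm b ^+ (2 ^ k).
Proof.
move=> sb; elim: k => [|k IH]; first by rewrite expn0 !expr1.
by rewrite expnSr !exprM cnorm_sqr_selfadjoint ?IH// starX sb.
Qed.

(* The elements d_k = x_k / (1 - x_k), x_k = b^(2^(k+1)), satisfy
   d_(k+1) = (x_k / (1 + x_k)) d_k, whose first factor has norm at most 1/2;
   but if b has norm 1 then all the x_k have norm 1, so d_k does not tend to 0. *)
Lemma selfadjoint_norm_lt1 b : star b = b -> cnorm b <= 1 ->
  invertible (1 - b ^+ 2) -> cnorm b < 1.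
Proof.
move=> sb b1 [w [w1 w2]]; rewrite lt_neqAle b1 andbT; apply/eqP => nb.
pose x k := b ^+ (2 ^ k.+1); pose C := cnorm (b ^+ 2 * w).
have n1 k : cnorm (b ^+ (2 ^ k)) = 1 by rewrite selfadjoint_pow2_norm// nb expr1n.
have H k : exists d, d * (1 - x k) = x k /\ cnorm d <= C * (1 / 2) ^+ k.
  elim: k => [|k [d [d1 d2]]].
    by exists (b ^+ 2 * w); rewrite /x expn1 -mulrA w1 !mulr1.
  pose y := b ^+ (2 ^ k); have sy : star y = y by rewrite starX sb.
  have [v [v1 v2]] := cayley_bound sy; pose e := y * (y * v).
  have xy : x k = y ^+ 2 by rewrite /x expnSr exprM.
  have ex : e * (1 + x k) = x k by rewrite xy /e -!mulrA v1 mulr1 expr2.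
  have xS : x k.+1 = x k * x k by rewrite /x expnSr exprM expr2.
  exists (e * d); split.
    rewrite xS -mulrA.
    have -> : 1 - x k * x k = (1 - x k) * (1 + x k).
      by rewrite mulrDr mulr1 mulrBl mul1r addrA addrNK.
    rewrite (mulrA d) d1 mulrDr mulr1 -[X in X + _]mul1r -mulrDl mulrA ex.
    by [].
  have ne : cnorm e <= 1 / 2.
    by apply: (le_trans (cnormM _ _)); rewrite n1 mul1r.
  apply: (le_trans (cnormM _ _)); rewrite exprS mulrCA.
  by apply: ler_pM => //; apply: cnorm_ge0.
have C0 : 0 <= C := cnorm_ge0 _.
(* This makes [C * (1 / 2) ^+ k] less than 1/2, against the lower bound 1/2 for [cnorm d] in [h1];
   the [+ 1] keeps the denominator positive when C = 0. *)
have [||k hk] := @geometric_small R (1 / 2) (1 / (2 * C + 1)); first by lra.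
  by apply: divr_gt0 => //; lra.
have [d [d1 d2]] := H k.
have h1 : 1 <= cnorm d * 2.
  rewrite -[X in X <= _](n1 k.+1) -/(x k) -[X in cnorm X <= _]d1.
  apply: (le_trans (cnormM _ _)).
  rewrite ler_wpM2l ?cnorm_ge0//; apply: (le_trans (cnormB _ _)).
  by rewrite cnorm1 n1.
have : 0 <= (1 / 2) ^+ k :> R by rewrite exprn_ge0.
move: hk d2; set t := _ ^+ k; rewrite ltr_pdivlMr; last by lra.
nra.
Qed.

(** If both points were missing, [1 - b] and [1 + b] would be invertible for the normalised b = h /
    cnorm h, hence also [1 - b ^+ 2], which forces [cnorm b < 1]. *)
Lemma selfadjoint_spectrum_norm h : star h = h ->
  spectrum h (cnorm h)%:C%C \/ spectrum h (- cnorm h)%:C%C.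
Proof.
move=> sh; apply: contrapT => /not_orP[/contrapT i1 /contrapT i2].
have [h0|n0] := eqVneq (cnorm h) 0.
  have := i1; rewrite h0 scale0r subr0 (cnorm_eq0 _ h0) => -[b []].
  by rewrite mulr0 => /esym/eqP; rewrite oner_eq0.
have h0 : 0 < cnorm h by rewrite lt_neqAle eq_sym n0 cnorm_ge0.
pose s := (cnorm h)%:C%C.
have s0 : s != 0 by rewrite -(rmorph0 (real_complex R)) (inj_eq (@complexI R)).
pose b := s^-1 *: h.
have ss : conjc s = s by rewrite conjc_real.
have sb : star b = b by rewrite starZ conjc_inv ss sh.
have nb : cnorm b = 1 by rewrite cnormZ cabsV cabs_real gtr0_norm// mulVf.
suff : cnorm b < 1 by rewrite nb ltxx.
apply: selfadjoint_norm_lt1; rewrite ?nb//.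
have -> : 1 - b ^+ 2 = (1 - b) * (1 + b).
  by rewrite mulrDr mulr1 mulrBl mul1r addrA addrNK expr2.
apply: invertibleM.
  have -> : 1 - b = (- s^-1) *: (h - s%:A).
    by rewrite scalerBr scalerA mulNr mulVf// scaleN1r opprK addrC scaleNr.
  by apply: invertibleZ; rewrite // oppr_eq0 invr_eq0.
have -> : 1 + b = s^-1 *: (h - (- s)%:A).
  by rewrite scalerBr scalerA mulrN mulVf// scaleN1r opprK addrC.
by apply: invertibleZ; rewrite ?invr_eq0//; move: i2; rewrite rmorphN.
Qed.

End SelfAdjointSpectrum.

(** * Positive elements, real and imaginary parts, contractivity of morphisms *)

Section PositiveElements.
Context {R : realType} {A : cstarAlgType R}.
Implicit Types (a b h x y : A) (c z : R[i]) (r s : R).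

Lemma spectrum_subr a z c : spectrum (c%:A - a) z -> spectrum a (c - z).
Proof.
rewrite addrC => /spectrum_unshift/spectrumN.
by rewrite opprK opprB.
Qed.

Lemma ge0_realE z : complex.Im z = 0 -> 0 <= complex.Re z -> 0 <= z.
Proof. by move=> z0 z1; rewrite lecE /= z0 eqxx. Qed.

(** The spectral value of [x] of modulus [cnorm x] yields [r - cnorm x] or [r + cnorm x] in the
    spectrum of [a]; positivity of [a] settles the first case and its norm the second. Through this
    inequality a norm-one functional with value 1 at [1] is seen to be positive. *)
Lemma cnorm_subr_positive a r : positive_elt a -> cnorm a <= r ->
  cnorm ((r%:C%C)%:A - a) <= r.
Proof.
move=> [sa pa] ar; set x := _ - a.
have sx : star x = x by rewrite starB starA conjc_real sa.
have r0 : 0 <= r := le_trans (cnorm_ge0 a) ar.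
have [/spectrum_subr|/spectrum_subr ax] := selfadjoint_spectrum_norm sx.
  by move=> /pa; rewrite -rmorphB ler0c subr_ge0.
have := spectrum_le_norm ax; rewrite -rmorphB cabs_real opprK.
by have := cnorm_ge0 x => h; rewrite ger0_norm ?addr_ge0//; lra.
Qed.

Lemma positive_addr h r : star h = h -> cnorm h <= r -> positive_elt ((r%:C%C)%:A + h).
Proof.
move=> sh hr; split; first by rewrite starD starA conjc_real sh.
move=> z; rewrite addrC => /spectrum_unshift hz.
have := spectrum_selfadjoint_real sh hz; rewrite ImD ImN /= subr0 => z0.
apply: ge0_realE => //.
have := le_trans (Re_le_cabs (- (z - r%:C%C))) (le_trans _ hr).
rewrite cabsN => /(_ (spectrum_le_norm hz)).
by rewrite ReN ReD ReN /= => ?; lra.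
Qed.

Lemma positive1 : positive_elt (1 : A).
Proof.
have := @positive_addr 0 1; rewrite star0 cnorm0 addr0 rmorph1 scale1r.
by apply.
Qed.

Definition re_part a : A := (2^-1 : R)%:C%C *: (a + star a).
Definition im_part a : A := re_part (- cI R *: a).

Lemma star_re_part a : star (re_part a) = re_part a.
Proof. by rewrite /re_part starZ conjc_real starD starK addrC. Qed.

Lemma cnorm_re_part a : cnorm (re_part a) <= cnorm a.
Proof.
rewrite cnormZ cabs_real ger0_norm ?invr_ge0//.
by have := cnormD a (star a); rewrite cnorm_star; lra.
Qed.

Lemma half2 : (2^-1 : R)%:C%C + (2^-1 : R)%:C%C = 1 :> R[i].
Proof. by rewrite -rmorphD -[RHS](rmorph1 (real_complex R)); congr (_%:C%C); lra. Qed.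

Lemma re_im_part a : a = re_part a + cI R *: im_part a.
Proof.
have -> : cI R *: im_part a = (2^-1 : R)%:C%C *: (a - star a).
  rewrite /im_part /re_part starZ scalerA mulrC -scalerA; congr (_ *: _).
  rewrite conj_NcI scalerDr !scalerA mulrN cI_sqr opprK scale1r.
  by rewrite scaleN1r.
by rewrite /re_part -scalerDr addrACA subrr addr0 scalerDr -scalerDl half2 scale1r.
Qed.

Lemma re_partD a b : re_part (a + b) = re_part a + re_part b.
Proof. by rewrite /re_part starD addrACA scalerDr. Qed.

Lemma re_part_realZ r a : re_part (r%:C%C *: a) = r%:C%C *: re_part a.
Proof. by rewrite /re_part starZ conjc_real -scalerDr !scalerA mulrC. Qed.

Lemma re_part_selfadjoint a : star a = a -> re_part a = a.
Proof. by move=> sa; rewrite /re_part sa scalerDr -scalerDl half2 scale1r. Qed.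

Lemma im_part_selfadjoint a : star a = a -> im_part a = 0.
Proof.
move=> sa; rewrite /im_part /re_part starZ sa conj_NcI scaleNr.
by rewrite addNr scaler0.
Qed.

End PositiveElements.

(** A unital homomorphism can only shrink spectra, and by the C*-identity it suffices to compare
    norms on [star a * a], where the norm of the image is a spectral value up to sign. *)
Lemma cnorm_morphism {R : realType} {A B : cstarAlgType R} (f : {lrmorphism A -> B}) :
  star_preserving f -> forall a, cnorm (f a) <= cnorm a.
Proof.
move=> sf a; rewrite -ler_sqr ?nnegrE ?cnorm_ge0// -!cstar_identity -sf -rmorphM.
set h := star a * a.
have sh : star (f h) = f h by rewrite -sf /h starM starK.
have fs z : spectrum (f h) z -> spectrum h z.
  move=> fz [b [b1 b2]]; apply: fz; exists (f b).
  by rewrite -(rmorph1 f) -linearZ -rmorphB -!rmorphM b1 b2.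
have [/fs|/fs] := selfadjoint_spectrum_norm sh => /spectrum_le_norm;
  by rewrite cabs_real ?normrN ger0_norm ?cnorm_ge0.
Qed.

(** * Positive functionals and states *)

Section PositiveFunctionals.
Context {R : realType} {A : cstarAlgType R}.
Implicit Types (a b h x y : A) (c z : R[i]) (r s : R).
Variable f : A -> R[i].
Hypothesis lf : scalar f.

Lemma scalar_functionalD a b : f (a + b) = f a + f b.
Proof. by rewrite -{1}[a]scale1r lf mul1r. Qed.

Lemma scalar_functional0 : f 0 = 0.
Proof. by apply: (addrI (f 0)); rewrite -scalar_functionalD !addr0. Qed.

Lemma scalar_functionalZ c a : f (c *: a) = c * f a.
Proof. by rewrite -[c *: a]addr0 lf scalar_functional0 addr0. Qed.

Lemma scalar_functionalN a : f (- a) = - f a.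
Proof. by rewrite -scaleN1r scalar_functionalZ mulN1r. Qed.

Lemma scalar_functionalB a b : f (a - b) = f a - f b.
Proof. by rewrite scalar_functionalD scalar_functionalN. Qed.

Hypothesis pf : forall a, positive_elt a -> 0 <= f a.

(** Both cnorm h + h and cnorm h - h are positive, so [f] is real and nonnegative on them. *)
Lemma positive_functional_selfadjoint h : star h = h ->
  complex.Im (f h) = 0 /\ complex.Re (f h) <= cnorm h * complex.Re (f 1).
Proof.
move=> sh.
have Im1 : complex.Im (f 1) = 0 := ger0_Im (pf positive1).
have := pf (positive_addr sh (lexx _)).
rewrite scalar_functionalD scalar_functionalZ lecE ImD ReD Im_realM Re_realM Im1 /=.
rewrite mulr0 add0r => /andP[/eqP hI _]; split => //.
have := @positive_addr _ _ (- h) (cnorm h); rewrite starN sh cnormN.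
move=> /(_ erefl (lexx _)) /pf.
rewrite scalar_functionalB scalar_functionalZ lecE ReD ReN Re_realM => /andP[_ /=].
by rewrite subr_ge0.
Qed.

Lemma positive_functional_star a : f (star a) = conjc (f a).
Proof.
have [rr _] := positive_functional_selfadjoint (star_re_part a).
have [ri _] := positive_functional_selfadjoint (star_re_part (- cI R *: a)).
have real z : complex.Im z = 0 -> conjc z = z by case: z => x y /= ->; rewrite oppr0.
move: (star_re_part a) (star_re_part (- cI R *: a)) rr ri (re_im_part a).
rewrite -/(im_part a); move: (re_part a) (im_part a) => x y sx sy rx ry ->.
rewrite starD starZ sx sy !scalar_functionalD !scalar_functionalZ.
by rewrite conjcD conjcM (real _ rx) (real _ ry).
Qed.

(** Multiplying [a] by the phase [c] makes the value of [f] real and nonnegative, so it is also the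
    value at a self-adjoint real part, where the previous bound applies. This takes the place of the
    Cauchy-Schwarz inequality. *)
Lemma positive_functional_bound a : cabs (f a) <= cnorm a * complex.Re (f 1).
Proof.
have [fa0|fa0] := eqVneq (f a) 0.
  rewrite fa0 cabs0 mulr_ge0 ?cnorm_ge0//.
  by have := pf positive1; rewrite lecE => /andP[].
pose t := cabs (f a); have t0 : 0 < t := cabs_gt0 fa0.
pose c := conjc (f a) * (t^-1)%:C%C.
have c1 : cabs c = 1.
  by rewrite cabsM cabs_conj cabs_real ger0_norm ?invr_ge0 ?ltW// mulfV// gt_eqF.
have fca : f (c *: a) = t%:C%C.
  rewrite scalar_functionalZ /c mulrAC [conjc _ * _]mulrC -sqr_normc cabsE -rmorphXn.
  by rewrite -rmorphM expr2 /= mulfK// gt_eqF.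
have fr : f (re_part (c *: a)) = t%:C%C.
  rewrite /re_part scalar_functionalZ scalar_functionalD positive_functional_star fca.
  by rewrite conjc_real mulrDr -mulrDl half2 mul1r.
have [_] := positive_functional_selfadjoint (star_re_part (c *: a)).
rewrite fr /= => /le_trans; apply; apply: ler_wpM2r.
  by have := pf positive1; rewrite lecE => /andP[].
by rewrite (le_trans (cnorm_re_part _))// cnormZ c1 mul1r.
Qed.

End PositiveFunctionals.

Section States.
Context {R : realType} {A : cstarAlgType R}.
Implicit Types (a b h : A) (f : A -> R[i]).

(** A positive functional has norm [f 1], so this normalisation can replace the supremum in
    [state_space]; unlike the latter it passes at once to compositions and convex combinations. *)
Definition is_state f :=
  [/\ scalar f, forall a, positive_elt a -> 0 <= f a & f 1 = 1].

Lemma state_spaceP f : state_space A f <-> is_state f.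
Proof.
have H : scalar f -> (forall a, positive_elt a -> 0 <= f a) ->
    functional_norm f = (complex.Re (f 1))%:E.
  move=> lf pf; apply/eqP; rewrite eq_le; apply/andP; split.
    apply: ge_ereal_sup => _ [a /= a1 <-]; rewrite lee_fin.
    apply: (le_trans (positive_functional_bound lf pf a)).
    by rewrite ler_piMl//; have := pf _ positive1; rewrite lecE => /andP[].
  apply: (@le_trans _ _ (cabs (f 1))%:E); first by rewrite lee_fin Re_le_cabs.
  by apply: ereal_sup_ubound; exists 1 => //=; rewrite cnorm1.
split=> -[lf pf f1]; split => //.
  move: f1; rewrite (H lf pf) => -[re1].
  have im1 := ger0_Im (pf _ positive1).
  by apply/eqP; rewrite eq_complex re1 im1 !eqxx.
by rewrite (H lf pf) f1.
Qed.

Lemma state_bound f a : is_state f -> cabs (f a) <= cnorm a.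
Proof.
by move=> [lf pf f1]; have := positive_functional_bound lf pf a; rewrite f1 mulr1.
Qed.

Lemma state_star f a : is_state f -> f (star a) = conjc (f a).
Proof. by move=> [lf pf f1]; apply: positive_functional_star. Qed.

Lemma stateZ f c a : is_state f -> f (c *: a) = c * f a.
Proof. by move=> [lf _ _]; apply: scalar_functionalZ. Qed.

Lemma stateD f a b : is_state f -> f (a + b) = f a + f b.
Proof. by move=> [lf _ _]; apply: scalar_functionalD. Qed.

Lemma stateB f a b : is_state f -> f (a - b) = f a - f b.
Proof. by move=> [lf _ _]; apply: scalar_functionalB. Qed.

End States.

(** * Hahn-Banach for sublinear functionals, by Zorn's lemma *)

Section HahnBanach.
Context {R : realType} {V : lmodType R[i]}.
Implicit Types (x y v : V) (r s t : R) (p q : V -> R).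

(** Only real scalars act, since the functional to be found is real-valued. The inequality at r and
    at 1/r together give equality. *)
Definition sublinear p := (forall x y, p (x + y) <= p x + p y) /\
  (forall r x, 0 < r -> p (r%:C%C *: x) <= r * p x).

Lemma sublinear0 p : sublinear p -> p 0 = 0.
Proof.
move=> [pD pZ]; have := pD 0 0; rewrite addr0 => h1.
have := @pZ (1 / 2) 0; rewrite scaler0 => h2.
by apply: le_anti; apply/andP; split; [have : 0 < 1 / 2 :> R by lra | ];
   [move=> /h2|]; lra.
Qed.

Lemma sublinearN p x : sublinear p -> - p (- x) <= p x.
Proof.
by move=> sp; have := sp.1 x (- x); rewrite subrr sublinear0// => ?; lra.
Qed.

(* A minimal sublinear functional equals all its descents, hence is odd, hence
   additive. *)
Definition descent p v x := inf [set p (x + t%:C%C *: v) - t * p v | t in [set t | 0 <= t]].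

Lemma descent_le p v x t : sublinear p -> 0 <= t ->
  descent p v x <= p (x + t%:C%C *: v) - t * p v.
Proof.
move=> sp t0; apply: ge_inf; last by exists t.
(* The infimum is genuine: p (x + s v) >= p (s v) - p (- x), and s p v <= p (s v) by homogeneity at
   1/s. *)
exists (- p (- x)) => _ [s s0 <-].
have h := sp.1 (x + s%:C%C *: v) (- x); rewrite addrAC subrr add0r in h.
suff : s * p v <= p (s%:C%C *: v) by lra.
move: s0; rewrite /= le_eqVlt => /predU1P[<-|s0]; first by rewrite mul0r scale0r sublinear0.
have := sp.2 s^-1 (s%:C%C *: v); rewrite invr_gt0 => /(_ s0).
rewrite scalerA -rmorphM mulVf ?gt_eqF// scale1r => h'.
by have := ler_wpM2l (ltW s0) h'; rewrite mulrA mulfV ?gt_eqF// mul1r.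
Qed.

Lemma le_descent p v x c :
  (forall t, 0 <= t -> c <= p (x + t%:C%C *: v) - t * p v) -> c <= descent p v x.
Proof.
move=> h; apply: lb_le_inf; first by exists (p (x + (0 : R)%:C%C *: v) - 0 * p v), 0 => /=.
by move=> _ [t t0 <-]; apply: h.
Qed.

Lemma descent_sublinear p v : sublinear p -> sublinear (descent p v).
Proof.
move=> sp; split=> [x y|r x r0].
  rewrite -lerBlDr; apply: le_descent => t t0; rewrite lerBlDr [X in _ <= X]addrC -lerBlDr.
  apply: le_descent => s s0; rewrite lerBlDr.
  apply: (le_trans (descent_le (t := t + s) _ _ sp _)); first exact: addr_ge0.
  rewrite rmorphD scalerDl addrACA.
  by have := sp.1 (x + t%:C%C *: v) (y + s%:C%C *: v) => ?; lra.
rewrite mulrC -ler_pdivrMr//; apply: le_descent => t t0; rewrite ler_pdivrMr//.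
apply: (le_trans (descent_le (t := r * t) _ _ sp _)); first exact: mulr_ge0 (ltW r0) t0.
rewrite rmorphM -scalerA -scalerDr; have := sp.2 r (x + t%:C%C *: v) r0.
by move: (p _) (p _) => ? ? ?; lra.
Qed.

Lemma descent_le_self p v x : sublinear p -> descent p v x <= p x.
Proof.
by move=> sp; have := @descent_le p v x 0 sp (lexx _); rewrite scale0r addr0 mul0r subr0.
Qed.

Lemma descent_opp p v : sublinear p -> descent p v (- v) <= - p v.
Proof.
move=> sp; have := @descent_le p v (- v) 1 sp ler01.
by rewrite scale1r addNr sublinear0// mul1r add0r.
Qed.

Lemma minimal_sublinear p : sublinear p ->
  exists q, [/\ sublinear q, forall x, q x <= p x &
    forall q', sublinear q' -> (forall x, q' x <= q x) -> forall x, q x <= q' x].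
Proof.
move=> sp; pose T := {q : V -> R | sublinear q /\ forall x, q x <= p x}.
pose p0 : T := exist _ p (conj sp (fun x => lexx _)).
(* The pointwise order is reversed, so that the maximal element given by Zorn's lemma is a minimal
   functional. *)
pose below : rel T := fun s t : T => `[< forall x, sval t x <= sval s x >].
have [|||q hq] := @ZL_preorder T p0 below.
- by move=> t; apply/asboolP.
- move=> r s t /asboolP h1 /asboolP h2; apply/asboolP => x.
  exact: le_trans (h2 x) (h1 x).
- move=> F tF; have [[f0 Ff0]|F0] := pselect (F !=set0); last first.
    by exists p0 => s Fs; case: F0; exists s.
  pose m x := inf [set sval f x | f in F].
  have mle f x : F f -> m x <= sval f x.
    move=> Ff; apply: ge_inf; last by exists f.
    exists (- p (- x)) => _ [g Fg <-]; have [sg gp] := svalP g.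
    by apply: le_trans (sublinearN x sg); rewrite lerN2.
  have m_ge x (c : R) : (forall f, F f -> c <= sval f x) -> c <= m x.
    move=> h; apply: lb_le_inf; first by exists (sval f0 x), f0.
    by move=> _ [f Ff <-]; apply: h.
  have sm : sublinear m.
    split=> [x y|r x r0].
      rewrite -lerBlDr; apply: (m_ge _ _) => f Ff; rewrite lerBlDr [X in _ <= X]addrC -lerBlDr.
      apply: (m_ge _ _) => g Fg; rewrite lerBlDr.
      have [sf _] := svalP f; have [sg _] := svalP g.
      (* Subadditivity of the infimum uses the chain: the smaller of [f] and [g] serves for both [x]
         and [y]. *)
      have [/asboolP h|/asboolP h] := tF f g Ff Fg.
        by have := mle g (x + y) Fg; have := sg.1 x y; have := h x => ? ? ?; lra.
      by have := mle f (x + y) Ff; have := sf.1 x y; have := h y => ? ? ?; lra.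
    rewrite mulrC -ler_pdivrMr//; apply: (m_ge _ _) => f Ff; rewrite ler_pdivrMr//.
    apply: (le_trans (mle f _ Ff)); have [sf _] := svalP f.
    by rewrite mulrC sf.2.
  have mp x : m x <= p x.
    by apply: (le_trans (mle f0 x Ff0)); have [_ ->] := svalP f0.
  exists (exist _ m (conj sm mp)) => f Ff; apply/asboolP => x /=.
  exact: mle.
have [sq qp] := svalP q; exists (sval q); split => // q' sq' q'q.
have q'p x : q' x <= p x := le_trans (q'q x) (qp x).
pose t : T := exist _ q' (conj sq' q'p).
have /hq/asboolP : below q t by apply/asboolP.
by [].
Qed.

(** Extension from the line through [v] is replaced by starting Zorn's lemma at the descent of [p]
    along [v]: it takes a value at most - p v at - v, so an odd minorant has value at least p v at
    v. *)
Lemma hahn_banach_sublinear p v : sublinear p ->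
  exists F : V -> R, [/\ forall x y, F (x + y) = F x + F y,
    forall r x, F (r%:C%C *: x) = r * F x,
    forall x, F x <= p x & F v = p v].
Proof.
move=> sp; have [F [sF Fd Fmin]] := minimal_sublinear (descent_sublinear v sp).
have FN x : F (- x) = - F x.
  apply: le_anti; apply/andP; split.
    have h := Fmin _ (descent_sublinear x sF) (fun y => descent_le_self x y sF) (- x).
    exact: le_trans h (descent_opp _ sF).
  by rewrite -[X in _ <= F X]opprK -lerN2 opprK; have := sublinearN x sF; lra.
have FD x y : F (x + y) = F x + F y.
  apply: le_anti; rewrite sF.1 /=; have := sF.1 (- x) (- y).
  by rewrite -opprD !FN; lra.
have Fp x : F x <= p x := le_trans (Fd x) (descent_le_self v x sp).
have FZ0 r x : 0 < r -> F (r%:C%C *: x) = r * F x.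
  move=> r0; apply: le_anti; rewrite sF.2//=.
  by have := sF.2 r (- x) r0; rewrite scalerN !FN mulrN lerN2.
exists F; split => //.
  move=> r x; have [r0|r0|->] := ltgtP r 0; last 2 first.
  - exact: FZ0.
  - by rewrite scale0r mul0r sublinear0.
  rewrite -[LHS]opprK -FN -scaleNr -rmorphN FZ0 ?oppr_gt0//.
  by rewrite mulNr opprK.
apply: le_anti; rewrite Fp /=.
by have := le_trans (Fd (- v)) (descent_opp v sp); rewrite FN lerN2.
Qed.

End HahnBanach.

(** * Norming states and separation of points *)

Section StatesSeparate.
Context {R : realType} {A : cstarAlgType R}.
Implicit Types (a b h : A) (f : A -> R[i]) (r : R) (c : R[i]).

Lemma re_part_cI a : re_part (cI R *: a) = - im_part a.
Proof.
rewrite /im_part /re_part !starZ conj_cI conj_NcI -scalerN; congr (_ *: _).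
by rewrite opprD !scaleNr opprK.
Qed.

Lemma im_part_cI a : im_part (cI R *: a) = re_part a.
Proof. by rewrite /im_part scalerA mulNr cI_sqr opprK scale1r. Qed.

Lemma im_partD a b : im_part (a + b) = im_part a + im_part b.
Proof. by rewrite /im_part scalerDr re_partD. Qed.

Lemma im_part_realZ r a : im_part (r%:C%C *: a) = r%:C%C *: im_part a.
Proof. by rewrite /im_part -re_part_realZ !scalerA mulrC. Qed.

(** Since [cnorm h] is in the spectrum, cnorm (1 + h) = 1 + cnorm h. A functional dominated by the
    norm that attains it at [1 + h] must then attain it at [1] and at [h] separately. *)
Lemma positive_norm_norming_state h : star h = h -> spectrum h (cnorm h)%:C%C ->
  exists f, is_state f /\ f h = (cnorm h)%:C%C.
Proof.
move=> sh hh; have sn : sublinear (cnorm : A -> R).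
  split=> [x y|r x r0]; first exact: cnormD.
  by rewrite cnormZ cabs_real gtr0_norm.
have n1h : cnorm (1 + h) = 1 + cnorm h.
  apply: le_anti; apply/andP; split; first by rewrite (le_trans (cnormD _ _))// cnorm1.
  have := spectrum_le_norm (spectrum_shift (c := 1) hh); rewrite scale1r addrC.
  rewrite -(rmorph1 (real_complex R)) -rmorphD cabs_real addrC.
  by rewrite ger0_norm ?addr_ge0 ?cnorm_ge0// ![_ + 1]addrC.
have [F [FD FZ Fn Fv]] := hahn_banach_sublinear (1 + h) sn.
have F1 : F 1 = 1 /\ F h = cnorm h.
  by have := Fn 1; have := Fn h; move: Fv; rewrite FD n1h cnorm1; lra.
have FN a : F (- a) = - F a.
  by have := FZ (-1) a; rewrite rmorphN scaleN1r mulN1r.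
have F0 : F 0 = 0 by have := FD 0 0; rewrite addr0; lra.
(* Complexification: [F] is only real-linear, and [f] agrees with it on self-adjoint elements. *)
pose f a := (F (re_part a))%:C%C + cI R * (F (im_part a))%:C%C.
have fs a : star a = a -> f a = (F a)%:C%C.
  by move=> sa; rewrite /f re_part_selfadjoint// im_part_selfadjoint// F0 mulr0 addr0.
have fD a b : f (a + b) = f a + f b.
  by rewrite /f re_partD im_partD !FD !rmorphD mulrDr addrACA.
have fZr r a : f (r%:C%C *: a) = r%:C%C * f a.
  rewrite /f re_part_realZ im_part_realZ; move: (re_part a) (im_part a) => x y.
  by rewrite !FZ !rmorphM mulrDr mulrCA.
have fI a : f (cI R *: a) = cI R * f a.
  rewrite /f re_part_cI im_part_cI FN; move: (re_part a) (im_part a) => x y.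
  by rewrite rmorphN mulrDr mulrA cI_sqr mulN1r addrC.
exists f; split; last by rewrite fs// F1.2.
split; last by rewrite fs ?star1// F1.1.
- move=> c a b; rewrite fD; congr (_ + _).
  rewrite {1 2}(complex_ReIm c) scalerDl fD fZr -scalerA fI fZr mulrDl mulrA.
  by [].
- move=> a pa; have [sa _] := pa; rewrite fs// ler0c.
  (* Positivity: cnorm a - F a = F (cnorm a - a) is at most the norm of cnorm a - a, hence at most
     cnorm a. *)
  have := Fn ((cnorm a)%:C%C%:A - a); rewrite FD FN FZ F1.1.
  by have := cnorm_subr_positive pa (lexx _); lra.
Qed.

Lemma norming_state h : star h = h -> exists f, is_state f /\ cabs (f h) = cnorm h.
Proof.
move=> sh; have [hh|hh] := selfadjoint_spectrum_norm sh.
  have [f [sf fh]] := positive_norm_norming_state sh hh.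
  by exists f; split => //; rewrite fh cabs_real ger0_norm ?cnorm_ge0.
have [||f [sf fh]] := @positive_norm_norming_state (- h).
- by rewrite starN sh.
- by rewrite cnormN; have := spectrumN hh; rewrite rmorphN opprK.
exists f; split => //; have [lf _ _] := sf.
move: fh; rewrite cnormN (scalar_functionalN lf) => fh.
by rewrite -cabsN fh cabs_real ger0_norm ?cnorm_ge0.
Qed.

Lemma states_separate a :
  (forall f g, is_state f -> is_state g -> f a = g a) -> exists c, a = c%:A.
Proof.
(* Applied to 0, [norming_state] merely provides some state. *)
move=> ha; have [f0 [sf0 _]] := @norming_state 0 star0.
exists (f0 a); apply/eqP; rewrite -subr_eq0; apply/eqP; set b := _ - _.
have vb f : is_state f -> f b = 0.
  move=> sf; rewrite /b stateB// stateZ//; have [_ _ ->] := sf.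
  by rewrite mulr1 (ha f f0)// subrr.
(* A state vanishing at [x] vanishes at [star x] as well, hence at [re_part x], whose norm is
   attained by a state. *)
have re0 x : (forall f, is_state f -> f x = 0) -> re_part x = 0.
  move=> vx; have [f [sf fx]] := norming_state (star_re_part x).
  apply: cnorm_eq0; rewrite -fx /re_part stateZ// stateD// state_star// vx//.
  by rewrite conjc0 addr0 mulr0 cabs0.
rewrite (re_im_part b) re0// /im_part re0 ?scaler0 ?addr0//.
by move=> f sf; rewrite stateZ// vb// mulr0.
Qed.

End StatesSeparate.

Section StateConstructions.
Context {R : realType} {A B : cstarAlgType R}.

Lemma positive_morphism (u : {lrmorphism A -> B}) a :
  star_preserving u -> positive_elt a -> positive_elt (u a).
Proof.
move=> su [sa pa]; split; first by rewrite -su sa.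
move=> z uz; apply: pa => -[b [b1 b2]]; apply: uz; exists (u b).
by rewrite -(rmorph1 u) -linearZ -rmorphB -!rmorphM b1 b2.
Qed.

Lemma state_comp (u : {lrmorphism A -> B}) f :
  star_preserving u -> is_state f -> is_state (f \o u).
Proof.
move=> su [lf pf f1]; split; rewrite /= ?rmorph1//.
- by move=> c a b /=; rewrite linearP lf.
- by move=> a /(positive_morphism su) /pf.
Qed.

(** Written from the base point [f] so that the difference from [f] is visibly t times g - f, the
    dilation on which [mk_dist_bounded] rests. *)
Lemma state_convex (f g : A -> R[i]) (t : R) : is_state f -> is_state g -> 0 <= t <= 1 ->
  is_state (fun a => f a + t%:C%C * (g a - f a)).
Proof.
move=> sf sg /andP[t0 t1]; split.
- by move=> c a b; rewrite !stateD// !stateZ//; ring.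
- move=> a pa; have [[_ pf _] [_ pg _]] := (sf, sg).
  have -> : f a + t%:C%C * (g a - f a) = (1 - t)%:C%C * f a + t%:C%C * g a.
    by rewrite rmorphB rmorph1; ring.
  by rewrite addr_ge0// mulr_ge0// ?pf ?pg// ler0c ?subr_ge0.
- by have [[_ _ ->] [_ _ ->]] := (sf, sg); rewrite subrr mulr0 addr0.
Qed.

End StateConstructions.

(** * The weak* topology through finitely many evaluations *)

Section WeakStarTopology.
Context {R : realType} {A : cstarAlgType R}.
Implicit Types (a : A) (s : seq A) (U : set (state_space A)).

Lemma state_space_val (mu : state_space A) : is_state (\val mu).
Proof. by apply/state_spaceP; exact: set_valP. Qed.

Lemma state_eval_near (mu : state_space A) a (e : R) : 0 < e ->
  \forall nu \near mu, cabs (\val mu a - \val nu a) < e.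
Proof.
move=> e0.
have vc : {for mu, continuous (fun nu : state_space A => (\val nu : {ptws A -> R[i]^o}))}.
  exact: initial_continuous.
have pc : {for (\val mu : {ptws A -> R[i]^o}),
    continuous (fun f : {ptws A -> R[i]^o} => (f a : R[i]^o))}.
  exact: (@proj_continuous A (fun=> R[i]^o) a).
have /cvgrPdist_lt/(_ e%:C%C) := continuous_comp vc pc.
rewrite ltcR => /(_ e0); apply: filterS => nu /=.
by rewrite cabsE ltcR.
Qed.

Lemma weak_star_openP U : open U <-> forall mu, U mu ->
  exists s (e : R), 0 < e /\ forall nu : state_space A,
    (forall a, a \in s -> cabs (\val mu a - \val nu a) < e) -> U nu.
Proof.
split=> [oU mu Umu|H].
  have [W oW WU] := oU.
  have Wmu : W (\val mu) by move: Umu; rewrite -WU.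
  (* These finite-evaluation neighbourhoods form a filter converging pointwise to [mu], so it
     contains the open set [W]; this replaces an explicit base of the product topology. *)
  pose F : set_system (A -> R[i]^o) := [set V | exists s (e : R), 0 < e /\
    forall f : A -> R[i], (forall a, a \in s -> cabs (\val mu a - f a) < e) -> V f].
  have FF : Filter F.
    split; first by exists [::], 1.
      move=> P Q [s [e [e0 sP]]] [s' [e' [e'0 sQ]]].
      exists (s ++ s'), (Num.min e e'); split; first by rewrite lt_min e0.
      move=> f hf; split; [apply: sP|apply: sQ] => a as'.
        by have := hf a; rewrite mem_cat as' => /(_ isT); rewrite lt_min => /andP[].
      by have := hf a; rewrite mem_cat as' orbT => /(_ isT); rewrite lt_min => /andP[].
    by move=> P Q PQ [s [e [e0 sP]]]; exists s, e; split => // f /sP /PQ.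
  have Fmu : {ptws, F --> (\val mu : A -> R[i]^o)}.
    apply/pointwise_cvgP => a; apply/cvgrPdist_lt => e e0.
    have eR : e = (complex.Re e)%:C%C.
      by apply/eqP; rewrite eq_complex /= (ger0_Im (ltW e0)) !eqxx.
    exists [:: a], (complex.Re e); split; first by rewrite -ltcR -eR.
    by move=> f /(_ a); rewrite inE eqxx => /(_ isT); rewrite cabsE eR ltcR.
  have [s [e [e0 h]]] : F W by apply: Fmu; apply: open_nbhs_nbhs.
  by exists s, e; split => // nu /h; rewrite -WU.
rewrite openE => mu /H [s [e [e0 sU]]].
apply: (@filterS _ _ _ [set nu : state_space A |
  forall a, a \in s -> cabs (\val mu a - \val nu a) < e]).
  by move=> nu; apply: sU.
elim: s {sU} => [|a s IH]; first by apply: filterE => nu a; rewrite in_nil.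
apply: filterS2 (state_eval_near mu a e0) IH => nu /= h1 h2 b.
by rewrite inE => /predU1P[->//|]; apply: h2.
Qed.

End WeakStarTopology.

(** * Monge-Kantorovich distances between states *)

Section MongeKantorovich.
Context {R : realType} {A : cstarAlgType R}.
Implicit Types (a b : A) (L : A -> \bar R) (f g h : A -> R[i]).

Lemma mk_dist_ge L f g a : (L a <= 1)%E -> ((cabs (f a - g a))%:E <= mk_dist L f g)%E.
Proof. by move=> La; apply: ereal_sup_ubound; exists a. Qed.

Lemma mk_dist_le L f g (x : \bar R) :
  (forall a, (L a <= 1)%E -> ((cabs (f a - g a))%:E <= x)%E) -> (mk_dist L f g <= x)%E.
Proof. by move=> h; apply: ge_ereal_sup => _ [a La <-]; apply: h. Qed.

Lemma mk_dist_refl L f : (mk_dist L f f <= 0)%E.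
Proof. by apply: mk_dist_le => a _; rewrite subrr cabs0. Qed.

Lemma lipschitz_seminorm0 L : lipschitz_seminorm L -> L 0 = 0%E.
Proof. by move=> [_ _ _ _ h _]; apply/h; exists 0; rewrite scale0r. Qed.

Lemma mk_dist_ge0 L f g : lipschitz_seminorm L -> (0 <= mk_dist L f g)%E.
Proof.
move=> sL; apply: (le_trans _ (@mk_dist_ge L f g 0 _)); first by rewrite lee_fin cabs_ge0.
by rewrite lipschitz_seminorm0// lee_fin.
Qed.

Lemma mk_dist_triangle L g f h : (mk_dist L f h <= mk_dist L f g + mk_dist L g h)%E.
Proof.
apply: mk_dist_le => a La.
apply: (le_trans _ (leeD (mk_dist_ge f g La) (mk_dist_ge g h La))).
by rewrite -EFinD lee_fin (le_trans _ (cabsD _ _))// subrKA.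
Qed.

Lemma mk_ball_open L f (e : R) : lipschitz_seminorm L ->
  mk_open L [set nu : state_space A | (mk_dist L f (\val nu) < e%:E)%E].
Proof.
move=> sL nu /= h.
have fin : mk_dist L f (\val nu) \is a fin_num.
  by rewrite ge0_fin_numE ?mk_dist_ge0//; apply: lt_trans h (ltry _).
exists (e - fine (mk_dist L f (\val nu))).
  by rewrite subr_gt0 -lte_fin fineK.
move=> nu' h'; apply: (le_lt_trans (mk_dist_triangle L (\val nu) _ _)).
by rewrite -(fineK fin) addrC -lteBrDr// -EFinB; exact: h'.
Qed.

Definition state_of f (sf : is_state f) : state_space A :=
  exist _ (f : {ptws A -> R[i]^o}) (mem_set ((state_spaceP f).2 sf)).

Lemma state_dist_norm f g a : is_state f -> is_state g -> cabs (f a - g a) <= 2 * cnorm a.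
Proof.
move=> sf sg; apply: (le_trans (cabsD _ _)); rewrite cabsN.
by have := state_bound a sf; have := state_bound a sg; lra.
Qed.

(* A Monge-Kantorovich ball around a state f contains a weak* neighbourhood of f,
   hence the states (1 - t) f + t g for all g and a common t > 0. *)
Lemma mk_dist_bounded L : lip_norm L -> exists2 D : R, 0 <= D &
  forall f g, is_state f -> is_state g -> (mk_dist L f g <= D%:E)%E.
Proof.
move=> [sL tL]; have [f0 [sf0 _]] := @norming_state R A 0 star0.
have /tL /weak_star_openP := @mk_ball_open L f0 1 sL.
move=> /(_ (state_of sf0)) /= []; first by rewrite (le_lt_trans (mk_dist_refl _ _))// lte_fin.
move=> s [e [e0 hs]]; pose M := \sum_(a <- s) cnorm a.
have M0 : 0 <= M by apply: sumr_ge0 => a _; apply: cnorm_ge0.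
have Ms a : a \in s -> cnorm a <= M.
  move=> as_; rewrite /M (big_rem a)//= lerDl.
  by apply: sumr_ge0 => b _; apply: cnorm_ge0.
(* Moving a fraction t from [f0] towards another state changes the value at a by at most 2 t cnorm
   a, hence by less than e for a in [s]; the [+ 1] covers M = 0. *)
pose t := Num.min 1 (e / (2 * M + 1)).
have t0 : 0 < t by rewrite lt_min ltr01 divr_gt0//; lra.
have t1 : t <= 1 by rewrite ge_min lexx.
have tM : 2 * t * M < e.
  have : t <= e / (2 * M + 1) by rewrite ge_min lexx orbT.
  by rewrite ler_pdivlMr; [nra | lra].
have D1 f : is_state f -> forall a, (L a <= 1)%E -> cabs (f0 a - f a) <= t^-1.
  move=> sf a La.
  have t01 : 0 <= t <= 1 by rewrite (ltW t0).
  pose ft := state_of (state_convex sf0 sf t01).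
  have ftE b : cabs (f0 b - \val ft b) = t * cabs (f0 b - f b).
    have -> : f0 b - \val ft b = - t%:C%C * (f b - f0 b).
      by rewrite /= opprD addrA subrr sub0r mulNr.
    by rewrite cabsM cabsN cabs_real gtr0_norm// cabsB.
  have lt1 : (mk_dist L f0 (\val ft) < 1%:E)%E.
    apply: hs => b bs; rewrite ftE; apply: le_lt_trans tM.
    have := state_dist_norm b sf0 sf; have := Ms b bs; have := t0.
    by move: (cabs _) (cnorm b) => ? ? ? ? ?; nra.
  have := le_lt_trans (mk_dist_ge f0 (\val ft) La) lt1.
  rewrite lte_fin ftE mulrC => /ltW.
  by rewrite -ler_pdivlMr// mul1r.
exists (t^-1 + t^-1); first by rewrite addr_ge0// invr_ge0 ltW.
move=> f g sf sg; apply: mk_dist_le => a La; rewrite lee_fin.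
rewrite -(subrKA (f0 a)); apply: (le_trans (cabsD _ _)).
by rewrite lerD// ?(cabsB (f a)) D1.
Qed.

(** A positive bound [r] instead of [L b] itself, so that [b] can be rescaled even when [L b] is
    0. *)
Lemma lipschitz_mk_dist L f g b (r : R) : lipschitz_seminorm L -> is_state f -> is_state g ->
  0 < r -> (L b <= r%:E)%E -> ((cabs (f b - g b))%:E <= r%:E * mk_dist L f g)%E.
Proof.
move=> sL sf sg r0 Lb.
have La : (L ((r^-1)%:C%C *: b) <= 1)%E.
  rewrite (lips_scale sL) cabs_real gtr0_norm ?invr_gt0//.
  by rewrite muleC lee_pdivrMr// mul1e.
have := mk_dist_ge f g La; rewrite !stateZ// -mulrBr cabsM cabs_real gtr0_norm ?invr_gt0// => h.
by rewrite muleC -lee_pdivrMr// -EFinM mulrC.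
Qed.

End MongeKantorovich.

(** * Series dominated by the dyadic weights *)

Section DyadicSeries.
Context {R : realType}.
Variable u : nat -> R.
Hypothesis u_dyadic : forall n, 0 <= u n <= 2 ^- n.+1.

Lemma dyadic_series_nondecreasing : nondecreasing_seq (series u).
Proof.
by apply/nondecreasing_seqP => n; rewrite seriesSr lerDl; have /andP[] := u_dyadic n.
Qed.

Lemma dyadic_series_tail N n : series u n <= series u N + 2 ^- N.
Proof.
(* Partial sums increased by 2^-n form a nonincreasing sequence, because the term of index n is at
   most half of 2^-n. *)
have H k : series u (N + k)%N + 2 ^- (N + k) <= series u N + 2 ^- N.
  elim: k => [|k IH]; first by rewrite addn0.
  apply: le_trans IH; rewrite addnS seriesSr -addrA lerD2l.
  have /andP[_ h] := u_dyadic (N + k); apply: (le_trans (lerD h (lexx _))).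
  by rewrite exprS invfM -mulrDl -[X in _ <= X]mul1r ler_wpM2r// ?invr_ge0 ?exprn_ge0//; lra.
have [Nn|nN] := leqP N n.
  by have := H (n - N)%N; rewrite subnKC//; apply: le_trans; rewrite lerDl invr_ge0 exprn_ge0.
apply: (le_trans (dyadic_series_nondecreasing (ltnW nN))).
by rewrite lerDl invr_ge0 exprn_ge0.
Qed.

Lemma dyadic_series_cvg : cvgn (series u).
Proof.
apply: nondecreasing_is_cvgn; first exact: dyadic_series_nondecreasing.
by exists (series u 0 + 2 ^- 0) => _ [n _ <-]; apply: dyadic_series_tail.
Qed.

Lemma dyadic_series_le_lim N : series u N <= limn (series u).
Proof. exact: nondecreasing_cvgn_le dyadic_series_nondecreasing dyadic_series_cvg N. Qed.

Lemma dyadic_series_lim_le N : limn (series u) <= series u N + 2 ^- N.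
Proof.
apply: limr_le; first exact: dyadic_series_cvg.
by apply: nearW => n; apply: dyadic_series_tail.
Qed.

Lemma dyadic_term_le_lim n : u n <= limn (series u).
Proof.
apply: le_trans (dyadic_series_le_lim n.+1); rewrite seriesSr lerDr.
by rewrite /series /=; apply: sumr_ge0 => i _; have /andP[] := u_dyadic i.
Qed.

End DyadicSeries.

(** * Open and dense sets in terms of norm balls *)

Section NormTopology.
Context {R : realType} {A : cstarAlgType R}.

Lemma cnorm_open_ball (O : set A) a : open O -> O a ->
  exists2 e : R, 0 < e & forall b, cnorm (a - b) < e -> O b.
Proof.
move=> oO Oa; have : nbhs a O by apply: open_nbhs_nbhs.
move=> /nbhsP[E]; rewrite cnorm_entourage => -[e e0 hE] EO.
by exists e => // b ab; apply: EO; rewrite /xsection /= inE; apply: hE.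
Qed.

Lemma cnorm_dense_approx (S : set A) a (e : R) : dense S -> 0 < e ->
  exists2 b, S b & cnorm (a - b) < e.
Proof.
move=> dS e0; have : nbhs a [set b | cnorm (a - b) < e].
  apply/nbhsP; exists [set ab | cnorm (ab.1 - ab.2) < e].
    by rewrite cnorm_entourage; exists e.
  by move=> b; rewrite /xsection /= inE.
rewrite nbhsE => -[U [oU Ua] Ue].
have [|b [Ub Sb]] := dS U _ oU; first by exists a.
by exists b => //; apply: Ue.
Qed.

End NormTopology.

(** * The metric rho and its Lipschitz seminorm on the limit algebra *)

Section LimitSeminorm.
Context {R : realType} (A : nat -> cstarAlgType R) (L : forall n, A n -> \bar R).
Context (Alim : cstarAlgType R) (psi : forall n, {lrmorphism A n -> Alim}).
Hypothesis hL : forall n, lip_norm (@L n).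
Hypothesis psi_star : forall n, star_preserving (psi n).
Hypothesis psi_dense : dense (\bigcup_n range (psi n)).
Implicit Types (mu nu f g : Alim -> R[i]) (a b : Alim).

Local Notation rho := (limit_dist L (fun n => psi n : A n -> Alim)).
Local Notation Llim := (limit_seminorm L (fun n => psi n : A n -> Alim)).
Local Notation dist n f g := (mk_dist (@L n) (f \o psi n) (g \o psi n)).

Definition limit_term f g n := 2 ^- n.+1 * (fine (dist n f g) / (1 + fine (dist n f g))).

Let sL n : lipschitz_seminorm (@L n) := lip_norm_seminorm (hL n).

Lemma fine_mk_dist_ge0 n f g : 0 <= fine (dist n f g).
Proof. by apply/fine_ge0/mk_dist_ge0. Qed.

Lemma limit_term_dyadic f g n : 0 <= limit_term f g n <= 2 ^- n.+1.
Proof.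
have d0 := fine_mk_dist_ge0 n f g; have p0 : 0 <= 2 ^- n.+1 :> R by rewrite invr_ge0 exprn_ge0.
have d1 : 0 < 1 + fine (dist n f g) by lra.
rewrite mulr_ge0//=; last by rewrite divr_ge0// ltW.
by rewrite ler_piMr// ler_pdivrMr// mul1r lerDr.
Qed.

Lemma limit_dist_ge0 f g : 0 <= rho f g.
Proof.
have /andP[t0 _] := limit_term_dyadic f g 0.
exact: le_trans t0 (dyadic_term_le_lim (limit_term_dyadic f g) 0).
Qed.

Lemma mk_dist_comp_fin n f g : is_state f -> is_state g ->
  dist n f g = (fine (dist n f g))%:E.
Proof.
move=> sf sg; rewrite fineK// ge0_fin_numE; last exact: mk_dist_ge0.
have [D _ hD] := mk_dist_bounded (hL n).
have := hD _ _ (state_comp (@psi_star n) sf) (state_comp (@psi_star n) sg).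
by move=> /le_lt_trans; apply; apply: ltry.
Qed.

(** The map d / (1 + d) can be undone linearly only on bounded d: for d <= D one has d <= (1 + D) (d
    / (1 + d)), and the last factor is at most 2^(n+1) rho. *)
Lemma mk_dist_le_limit_dist n : exists2 K : R, 0 < K & forall f g, is_state f -> is_state g ->
  fine (dist n f g) <= K * rho f g.
Proof.
have [D D0 hD] := mk_dist_bounded (hL n).
exists (2 ^+ n.+1 * (1 + D)); first by rewrite mulr_gt0 ?exprn_gt0//; lra.
move=> f g sf sg; set d := fine _.
have dD : d <= D.
  rewrite -lee_fin -mk_dist_comp_fin//.
  exact: hD (state_comp (@psi_star n) sf) (state_comp (@psi_star n) sg).
have d0 : 0 <= d := fine_mk_dist_ge0 n f g.
have d1 : 0 < 1 + d by lra.
have h : limit_term f g n <= rho f g := dyadic_term_le_lim (limit_term_dyadic f g) n.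
have p0 : 0 < 2 ^+ n.+1 :> R by rewrite exprn_gt0.
have {}h : d <= 2 ^+ n.+1 * rho f g * (1 + d).
  rewrite -ler_pdivrMr//; have := ler_wpM2l (ltW p0) h.
  by rewrite /limit_term mulrA mulfV ?gt_eqF// mul1r.
apply: (le_trans h); rewrite mulrAC; apply: (ler_wpM2r (limit_dist_ge0 f g)).
by rewrite ler_wpM2l ?(ltW p0)// lerD2l.
Qed.

Lemma image_lipschitz n (b : A n) : (L b < +oo)%E -> exists2 K : R, 0 <= K &
  forall f g, is_state f -> is_state g ->
    cabs (f (psi n b) - g (psi n b)) <= K * rho f g.
Proof.
move=> Lb; have [K K0 hK] := mk_dist_le_limit_dist n.
have Lfin : L b \is a fin_num by rewrite ge0_fin_numE ?(lips_ge0 (sL n)).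
have L0 : 0 <= fine (L b) by apply/fine_ge0/(lips_ge0 (sL n)).
pose r := fine (L b) + 1; have r0 : 0 < r by rewrite /r; lra.
have Lr : (L b <= r%:E)%E by rewrite -(fineK Lfin) lee_fin lerDl.
exists (r * K); first by rewrite mulr_ge0 ?ltW.
move=> f g sf sg.
have := lipschitz_mk_dist (sL n) (state_comp (@psi_star n) sf)
  (state_comp (@psi_star n) sg) r0 Lr.
rewrite mk_dist_comp_fin// -EFinM lee_fin /= => /le_trans; apply.
by rewrite -mulrA ler_wpM2l ?(ltW r0)// hK.
Qed.

Lemma lipschitz_image_dense :
  dense [set a : Alim | exists n (b : A n), a = psi n b /\ (L b < +oo)%E].
Proof.
move=> O [a0 Oa0] oO.
have [a [ Oa [n _ [b _ ba]]]] := psi_dense (ex_intro _ a0 Oa0) oO.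
have [e e0 eO] := cnorm_open_ball oO Oa.
have [c Lc bc] := cnorm_dense_approx b (lips_dense (sL n)) e0.
exists (psi n c); split; last by exists n, c.
apply: eO; rewrite -ba -rmorphB; apply: le_lt_trans bc.
exact: cnorm_morphism.
Qed.

(** If rho vanished, [f] and [g] would agree on the dense set of Lipschitz images. An element within
    e / 2 of [a] suffices, as two states differ by at most twice the norm. *)
Lemma limit_dist_gt0 f g a : is_state f -> is_state g -> f a != g a -> 0 < rho f g.
Proof.
move=> sf sg fga; pose e := cabs (f a - g a).
have e0 : 0 < e by rewrite cabs_gt0// subr_eq0.
have e20 : 0 < e / 2 by lra.
have [_ [n [b [-> Lb]]] ab] := cnorm_dense_approx a lipschitz_image_dense e20.
have [K K0 hK] := image_lipschitz Lb.
rewrite lt_neqAle limit_dist_ge0 andbT; apply/eqP => rho0.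
have := hK f g sf sg; rewrite -rho0 mulr0 => h.
have fg : f (psi n b) - g (psi n b) = 0.
  by apply: cabs_eq0; apply: le_anti; rewrite h cabs_ge0.
have := state_dist_norm (a - psi n b) sf sg.
have -> : f (a - psi n b) - g (a - psi n b) = f a - g a.
  rewrite !stateB//; have /eqP := fg; rewrite subr_eq0 => /eqP ->.
  by rewrite opprB addrA addrNK.
by rewrite -/e; lra.
Qed.

(** The seminorm properties and the comparison with rho go through this form. It can range over all
    pairs: one with [f a = g a] is harmless for K >= 0, and any other has rho > 0, so the quotient
    can be cleared. *)
Lemma limit_seminormP (K : R) a : 0 <= K -> (Llim a <= K%:E)%E <->
  (forall f g, is_state f -> is_state g -> cabs (f a - g a) <= K * rho f g).
Proof.
move=> K0; split=> [h f g sf sg|h].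
  have [->|fga] := eqVneq (f a) (g a).
    by rewrite subrr cabs0 mulr_ge0// limit_dist_ge0.
  rewrite -ler_pdivrMr ?(limit_dist_gt0 sf sg fga)// -lee_fin; apply: le_trans h.
  rewrite le_max; apply/orP; right; apply: ereal_sup_ubound.
  exists (state_of sf), (state_of sg); split => // /(congr1 \val) /= fg.
  by move: fga; rewrite fg eqxx.
rewrite ge_max lee_fin K0 /=; apply: ge_ereal_sup => _ [mu [nu [munu ->]]].
have [b mub] : exists b, \val mu b != \val nu b.
  apply: contrapT => H; apply: munu; apply/val_inj/funext => b.
  by apply/eqP/negPn/negP => ab; apply: H; exists b.
have smu := state_space_val mu; have snu := state_space_val nu.
by rewrite lee_fin ler_pdivrMr ?h// (limit_dist_gt0 smu snu mub).
Qed.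

Lemma limit_seminorm_ge0 a : (0 <= Llim a)%E.
Proof. by rewrite le_max lexx. Qed.

Lemma limit_seminorm_fin a : (Llim a < +oo)%E -> exists2 K : R, 0 <= K & Llim a = K%:E.
Proof.
move=> h; have fa : Llim a \is a fin_num by rewrite ge0_fin_numE ?limit_seminorm_ge0.
by exists (fine (Llim a)); [exact/fine_ge0/limit_seminorm_ge0 | rewrite fineK].
Qed.

(** The reverse inequality is this one at [c^-1] and [c *: a]. For [c != 0] an infinite value stays
    infinite after scaling. *)
Lemma limit_seminormZ_le (c : R[i]) a : c != 0 ->
  (Llim (c *: a) <= (cabs c)%:E * Llim a)%E.
Proof.
move=> c0; have [|fa] := leP +oo%E (Llim a).
  by rewrite leye_eq => /eqP ->; rewrite gt0_muley ?leey// lte_fin cabs_gt0.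
have [K K0 LK] := limit_seminorm_fin fa; rewrite LK -EFinM.
apply/limit_seminormP => [|f g sf sg]; first by rewrite mulr_ge0// cabs_ge0.
rewrite !stateZ// -mulrBr cabsM -mulrA ler_wpM2l ?cabs_ge0//.
by apply: (limit_seminormP a K0).1 => //; rewrite LK.
Qed.

Lemma limit_seminorm_star_le a : (Llim (star a) <= Llim a)%E.
Proof.
have [|fa] := leP +oo%E (Llim a); first by rewrite leye_eq => /eqP ->; rewrite leey.
have [K K0 LK] := limit_seminorm_fin fa; rewrite LK.
apply/limit_seminormP => // f g sf sg; rewrite !state_star//.
have -> : conjc (f a) - conjc (g a) = conjc (f a - g a).
  exact/esym/(rmorphB (@conjc R)).
by rewrite cabs_conj; apply: (limit_seminormP a K0).1 => //; rewrite LK.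
Qed.

Lemma limit_seminorm_lipschitz : lipschitz_seminorm Llim.
Proof.
split.
- exact: limit_seminorm_ge0.
- move=> a b; have [|fa] := leP +oo%E (Llim a).
    rewrite leye_eq => /eqP ->; rewrite addye ?leey//.
    by rewrite gt_eqF// (lt_le_trans (ltNye 0))// limit_seminorm_ge0.
  have [|fb] := leP +oo%E (Llim b).
    rewrite leye_eq => /eqP ->; rewrite addey ?leey//.
    by rewrite gt_eqF// (lt_le_trans (ltNye 0))// limit_seminorm_ge0.
  have [K K0 LK] := limit_seminorm_fin fa; have [M M0 LM] := limit_seminorm_fin fb.
  rewrite LK LM -EFinD; apply/limit_seminormP => [|f g sf sg]; first exact: addr_ge0.
  rewrite !stateD// opprD addrACA (le_trans (cabsD _ _))// mulrDl lerD//.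
    by apply: (limit_seminormP a K0).1 => //; rewrite LK.
  by apply: (limit_seminormP b M0).1 => //; rewrite LM.
- move=> c a; have [->|c0] := eqVneq c 0.
    rewrite cabs0 mul0e; apply/eqP; rewrite eq_le limit_seminorm_ge0 andbT.
    apply/limit_seminormP => // f g sf sg.
    have [[lf _ _] [lg _ _]] := (sf, sg).
    by rewrite scale0r (scalar_functional0 lf) (scalar_functional0 lg) subrr cabs0 mul0r.
  apply/eqP; rewrite eq_le limit_seminormZ_le//=.
  have := @limit_seminormZ_le c^-1 (c *: a); rewrite invr_eq0 => /(_ c0).
  rewrite scalerA mulVf// scale1r cabsV => h.
  by rewrite muleC -lee_pdivlMr ?cabs_gt0// muleC.
- move=> a; apply/eqP; rewrite eq_le limit_seminorm_star_le/=.
  by rewrite -{1}[a]starK limit_seminorm_star_le.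
- move=> a; split=> [La|[c ->]].
    apply: states_separate => f g sf sg; apply/eqP; rewrite -subr_eq0; apply/eqP.
    apply: cabs_eq0; apply: le_anti; rewrite cabs_ge0 andbT.
    by rewrite -(mul0r (rho f g)); apply: (limit_seminormP a (lexx 0)).1 => //; rewrite La.
  apply/eqP; rewrite eq_le limit_seminorm_ge0 andbT.
  apply/limit_seminormP => // f g sf sg; rewrite !stateZ//.
  by have [[_ _ ->] [_ _ ->]] := (sf, sg); rewrite subrr cabs0 mul0r.
- move=> O O0 oO; have [a [Oa [n [b [ab Lb]]]]] := lipschitz_image_dense O0 oO.
  exists a; split => //=; have [K K0 hK] := image_lipschitz Lb.
  apply: (@le_lt_trans _ _ K%:E); last exact: ltry.
  by apply/limit_seminormP => // f g sf sg; rewrite ab hK.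
Qed.

Lemma mk_dist_weak_star_small n f (d : R) : is_state f -> 0 < d ->
  exists (s : seq Alim) (e : R), 0 < e /\ forall g, is_state g ->
    (forall a, a \in s -> cabs (f a - g a) < e) -> (dist n f g < d%:E)%E.
Proof.
move=> sf d0; have sfn := state_comp (@psi_star n) sf.
have /(lip_norm_topology (hL n))/weak_star_openP :=
  @mk_ball_open _ _ (@L n) (f \o psi n) d (lip_norm_seminorm (hL n)).
move=> /(_ (state_of sfn)) /= []; first by rewrite (le_lt_trans (mk_dist_refl _ _))// lte_fin.
move=> s [e [e0 hs]]; exists (map (psi n) s), e; split => // g sg hg.
apply: (hs (state_of (state_comp (@psi_star n) sg))) => b bs /=.
by apply: hg; apply: map_f.
Qed.

Lemma mk_dists_weak_star_small N f (d : R) : is_state f -> 0 < d ->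
  exists (s : seq Alim) (e : R), 0 < e /\ forall g, is_state g ->
    (forall a, a \in s -> cabs (f a - g a) < e) ->
    forall n, (n < N)%N -> (dist n f g < d%:E)%E.
Proof.
move=> sf d0; elim: N => [|N [s [e [e0 hs]]]]; first by exists [::], 1.
have [s' [e' [e'0 hs']]] := mk_dist_weak_star_small N sf d0.
exists (s ++ s'), (Num.min e e'); split; first by rewrite lt_min e0.
move=> g sg hg n; rewrite ltnS leq_eqVlt => /predU1P[->|].
  apply: hs' => // a as'; have := hg a; rewrite mem_cat as' orbT => /(_ isT).
  by rewrite lt_min => /andP[].
apply: hs => // a as'; have := hg a; rewrite mem_cat as' => /(_ isT).
by rewrite lt_min => /andP[].
Qed.

Lemma limit_dist_weak_star_small f (e : R) : is_state f -> 0 < e ->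
  exists (s : seq Alim) (e' : R), 0 < e' /\ forall g, is_state g ->
    (forall a, a \in s -> cabs (f a - g a) < e') -> rho f g < e.
Proof.
move=> sf e0; have e20 : 0 < e / 2 by lra.
(* The tail after N terms is at most 2^-N < e / 2; in the first N terms d / (1 + d) is at most e /
   2, and their weights add up to 1 - 2^-N. *)
have [|N hN] := @geometric_small R 2^-1 (e / 2) _ e20; first by lra.
have [s [e' [e'0 hs]]] := mk_dists_weak_star_small N sf e20.
exists s, e'; split => // g sg /(hs g sg) hd.
have H k : (k <= N)%N -> series (limit_term f g) k <= e / 2 * (1 - 2^-1 ^+ k).
  elim: k => [_|k IH kN]; first by rewrite /series /= big_geq// expr0 subrr mulr0.
  rewrite seriesSr; have {IH} := IH (ltnW kN).
  have := hd k kN; rewrite mk_dist_comp_fin// lte_fin.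
  have := fine_mk_dist_ge0 k f g; rewrite /limit_term.
  move: (fine _) => x x0 xe; rewrite -exprVn exprS.
  have : 0 <= 2^-1 ^+ k :> R by rewrite exprn_ge0.
  have : x / (1 + x) <= e / 2.
    by rewrite ler_pdivrMr; [nra | lra].
  have : 0 <= x / (1 + x) by rewrite divr_ge0//; lra.
  by move: (_ ^+ k) (x / _) => p y; nra.
apply: (le_lt_trans (dyadic_series_lim_le (limit_term_dyadic f g) N)).
rewrite -exprVn; have := H N (leqnn N); have : 0 <= 2^-1 ^+ N :> R by rewrite exprn_ge0.
by move: hN; move: (_ ^+ N) => p; nra.
Qed.

Lemma states_near_on_seq (M : Alim -> \bar R) f (s : seq Alim) (e : R) :
  lipschitz_seminorm M -> is_state f -> 0 < e -> exists2 d : R, 0 < d &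
    forall g, is_state g -> (mk_dist M f g < d%:E)%E ->
      forall a, a \in s -> cabs (f a - g a) < e.
Proof.
move=> sM sf e0; elim: s => [|a s [d d0 hd]]; first by exists 1.
(* On [a - b] two states differ by at most 2 cnorm (a - b) < e / 2. The other half is left for [b],
   where the bound e / 2 / r on the distance is multiplied by r. *)
have [|b Mb ab] := @cnorm_dense_approx _ _ _ a (e / 4) (lips_dense sM); first by lra.
have bfin : M b \is a fin_num by rewrite ge0_fin_numE ?(lips_ge0 sM).
have M0 : 0 <= fine (M b) by apply/fine_ge0/(lips_ge0 sM).
pose r := fine (M b) + 1; have r0 : 0 < r by rewrite /r; lra.
have Mr : (M b <= r%:E)%E by rewrite -(fineK bfin) lee_fin lerDl.
exists (Num.min d (e / 2 / r)); first by rewrite lt_min d0 !divr_gt0.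
move=> g sg hg c; rewrite inE => /predU1P[->|]; last first.
  by apply: hd => //; apply: lt_le_trans hg _; rewrite lee_fin ge_min lexx.
have h1 : cabs (f b - g b) < e / 2.
  rewrite -lte_fin; apply: (le_lt_trans (lipschitz_mk_dist sM sf sg r0 Mr)).
  rewrite muleC -lte_pdivlMr// -EFinM; apply: lt_le_trans hg _.
  by rewrite lee_fin ge_min lexx orbT.
have h2 := state_dist_norm (a - b) sf sg.
have -> : f a - g a = (f (a - b) - g (a - b)) + (f b - g b).
  by rewrite -[in LHS](addrNK b a) !stateD// opprD addrACA.
by apply: (le_lt_trans (cabsD _ _)); lra.
Qed.

Lemma limit_seminorm_lip_norm : lip_norm Llim.
Proof.
have sM := limit_seminorm_lipschitz; split => // U; split=> [mU|oU].
  apply/weak_star_openP => mu /mU[e e0 eU].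
  have smu := state_space_val mu.
  have [s [e' [e'0 hs]]] := limit_dist_weak_star_small smu e0.
  exists s, e'; split => // nu hnu; apply: eU.
  have snu := state_space_val nu.
  apply: (@le_lt_trans _ _ (rho (\val mu) (\val nu))%:E); last by rewrite lte_fin hs.
  apply: mk_dist_le => a La; rewrite lee_fin -[X in _ <= X]mul1r.
  exact: (limit_seminormP a ler01).1.
move=> mu Umu; have [s [e [e0 sU]]] := (weak_star_openP U).1 oU mu Umu.
have [d d0 hd] := states_near_on_seq s sM (state_space_val mu) e0.
by exists d => // nu /(hd _ (state_space_val nu))/sU.
Qed.

End LimitSeminorm.

Theorem theorem3p6 (R : realType) (A : nat -> cstarAlgType R)
    (L : forall n : nat, A n -> \bar R)
    (phi : forall n : nat, {lrmorphism A n -> A n.+1})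
    (hL : forall n : nat, lip_norm (L n))
    (hphi : forall n : nat, star_preserving (phi n))
    (hdom : forall (n : nat) (a : A n),
      (L n a < +oo)%E -> (L n.+1 (phi n a) < +oo)%E)
    (Alim : cstarAlgType R) (psi : forall n : nat, {lrmorphism A n -> Alim})
    (hlim : inductive_limit phi psi) :
  lip_norm (limit_seminorm L (fun n => psi n : A n -> Alim)).
Proof.
exact: (limit_seminorm_lip_norm hL (indlim_star hlim) (indlim_dense hlim)).
Qed.
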